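(* Let $0 < \epsilon < 0.1$, let $X \ge 1$ and let $H$ be a real number with $X^{3\epsilon} \le H \le X^{1/2-\epsilon}$. For each $x$ put $y = y(x) = 2\sqrt{x}\,H + H^2$. Then $$\frac{1}{X} \int_{X}^{2X} \Big| Q(x+y) - Q(x) - \frac{\zeta(3/2)}{\zeta(3)} H \Big|^2 dx = \bigl(1 + O(X^{-\epsilon/2})\bigr)\, 2H^2 \sum_{b \le X^{1/4}} \frac{\mu^2(b)}{b^3} \sum_{n \ge 1} S\Bigl( \frac{nH}{b^{3/2}} \Bigr)^2 + O_\epsilon\Bigl( H^{4/3} + \frac{H^{5/3+\epsilon}}{X^{1/16}} + \frac{H^{2+\epsilon}}{X^{1/8}} \Bigr).$$
   Context: A positive integer $n$ is squarefull if $p^2 \mid n$ for every prime $p \mid n$ (so $1$ is squarefull). $Q(x)$ denotes the number of squarefull positive integers $n \le x$. $\zeta$ is the Riemann zeta function, $\mu$ is the Möbius function, and $S(x) = \frac{\sin \pi x}{\pi x}$. The sums over $b$ and $n$ are over positive integers. $O_\epsilon(g)$ denotes a quantity bounded in absolute value by $C g$ with $C > 0$ depending only on $\epsilon$; the constant implied by $O(X^{-\epsilon/2})$ may also depend on $\epsilon$. *)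

(* Defs.v *)
From HB Require Import structures.
From mathcomp Require Export all_boot all_order all_algebra.
From mathcomp Require Export all_classical all_reals all_analysis.
Export Order.TTheory GRing.Theory Num.Theory.
Export numFieldNormedType.Exports.

Set Implicit Arguments.
Unset Strict Implicit.
Unset Printing Implicit Defensive.

Local Open Scope classical_set_scope.
Local Open Scope ring_scope.

Definition squarefull (n : nat) : bool :=
  (0 < n)%N && all (fun p => p ^ 2 %| n)%N (primes n).

(* For x < 0, [Num.truncn x] is 0 and the count is 0. *)
Definition squarefull_count (R : realType) (x : R) : nat :=
  count squarefull (iota 1 (Num.truncn x)).

Definition squarefree (n : nat) : bool :=
  (0 < n)%N && all (fun p => ~~ (p ^ 2 %| n))%N (primes n).

Definition moebius (n : nat) : int :=
  if squarefree n then (-1) ^+ size (primes n) else 0.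

(* The Dirichlet series of the Riemann zeta function; it represents zeta(s)
   only for s > 1, where the series converges. *)
Definition zeta (R : realType) (s : R) : R :=
  \big[+%R/0]_(1 <= n <oo) (n%:R `^ s)^-1.

(* The normalized sinc function, extended by continuity at 0. *)
Definition sinc (R : realType) (x : R) : R :=
  if x == 0 then 1 else sin (pi * x) / (pi * x).

(* Main.v *)
Require Import Defs.
From mathcomp Require Import measurable_realfun zify ring lra.

Set Implicit Arguments.
Unset Strict Implicit.
Unset Printing Implicit Defensive.

Local Open Scope classical_set_scope.
Local Open Scope ring_scope.

(** Write [H = h ^ 3], [u = sqrt x] and [c b = b ^ (3/2)], so that
    [x + y = (u + H) ^ 2].  Both sides are [O(H ^ (4/3)) = O(h ^ 4)], hence the
    identity holds with [theta = 0] and [E] the difference of the two sides.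

    The main term is even [O(H)]: since [sinc v ^ 2 = O((1 + v) ^ -2)], the sum
    over [n] is [O(c b / H)], and [c b / b ^ 3 = 1 / c b] is summable over [b].

    For the variance, every squarefull number is [a ^ 2 * b ^ 3] with [b]
    squarefree in exactly one way, so that [Q(x + y) - Q(x)] is the sum over
    squarefree [b] of the number of [a] with [u < a * c b <= u + H], each of
    which should be close to [H / c b].  The constant [zeta (3/2) / zeta 3] is
    the sum of [1 / c b] over squarefree [b], because every positive integer is
    [m ^ 2 * b] with [b] squarefree in exactly one way.  For [b <= h ^ 2] the
    error of each term is at most [1], and for [b > h ^ 2] the expected total
    [H * sum 1 / c b] is [O(H / h)]; both are [O(h ^ 2)] for each [x]
    ([squarefull_count_pointwise]).  It remains to bound the mean square of the
    number of lattice values [a * c b] in [(u, u + H]] with [b > h ^ 2].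

    Split [b] into blocks [d ^ 2 <= b < 4 d ^ 2] with [d = 2 ^ j * h]; a weighted
    Cauchy-Schwarz inequality reduces the problem to one block at a time, as
    long as the bounds for the blocks decay geometrically.  Expanding the
    square, two values [a * c b] and [a' * c b'] contribute only if they are at
    distance at most [H], and then for a set of [x] of measure [O(sqrt X * H)].
    Such a pair makes the fraction [a / a'] close to the [3/2]-th power of the
    fraction [b' / b], to precision [O(H / sqrt X)]; conversely each pair of
    reduced fractions [p / q], [m / n] comes from at most [N1 / q * (N2 / n)]
    pairs, where [N1] and [N2] bound the denominators.  So the weighted count
    of the pairs of close reduced fractions is wanted ([close_fractions_count]).
    For a given [m / n], all the admissible [p / q] lie in one short interval,
    and distinct fractions [r], [r'] with denominators [q], [q'] satisfy
    [1 / q <= q' * |r - r'| <= N1 * |r - r'|]; therefore the sum of [1 / q],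
    with one fraction left out, is at most [N1] times the length of the interval
    ([gap_sum]).  The same holds with the two sides exchanged, and the pairs left
    out on both sides form a matching, over which [1 / (q * n)] sums to
    [O(log X)] ([bilinear_matching]).  The block of [d] thus contributes
    [O((H / d) * (H / d + log X))], and [log X = O(X ^ (2 * eps)) = O(h ^ 2)]. *)

(** * Squarefree parts and squarefull numbers *)

Lemma squarefree_gt0 n : squarefree n -> (0 < n)%N.
Proof. by case/andP. Qed.

Lemma logn_squarefree p n : squarefree n -> (logn p n <= 1)%N.
Proof.
case/andP=> n0 /allP sf; rewrite leqNgt; apply/negP => h.
have pp : p \in primes n by rewrite -logn_gt0; apply: ltnW.
by have := sf p pp; rewrite pfactor_dvdn ?h //; move: pp; rewrite mem_primes => /andP[].
Qed.

(** Divide [n] by its largest square divisor. *)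
Lemma squarefree_part_exists n : (0 < n)%N ->
  exists m b, [/\ (0 < m)%N, squarefree b & n = (m ^ 2 * b)%N].
Proof.
move=> n0.
have ex : exists m, (0 < m)%N && (m ^ 2 %| n)%N by exists 1%N; rewrite exp1n dvd1n.
have ub m : (0 < m)%N && (m ^ 2 %| n)%N -> (m <= n)%N.
  case/andP=> m0 /(dvdn_leq n0) le; apply: leq_trans le.
  by rewrite -mulnn leq_pmulr.
case: (ex_maxnP ex ub) => m /andP[m0 /dvdnP[b nE]] mmax.
have b0 : (0 < b)%N by move: n0; rewrite nE muln_gt0 => /andP[].
exists m, b; split=> //; last by rewrite mulnC.
rewrite /squarefree b0 /=; apply/allP => p; rewrite mem_primes => /and3P[pp _ _].
apply/negP => /dvdnP[c bE].
have := mmax (p * m)%N; rewrite muln_gt0 prime_gt0 // m0 /= nE bE.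
rewrite -mulnA -expnMn dvdn_mull // => /(_ isT).
by rewrite -{2}[m]mul1n leq_pmul2r // leqNgt prime_gt1.
Qed.

(** The exponents of [b] are those of [m ^ 2 * b] modulo 2. *)
Lemma squarefree_part_uniq m m' b b' : (0 < m)%N -> (0 < m')%N ->
  squarefree b -> squarefree b' -> (m ^ 2 * b = m' ^ 2 * b')%N -> m = m' /\ b = b'.
Proof.
move=> m0 m0' sb sb' e.
have b0 := squarefree_gt0 sb; have b0' := squarefree_gt0 sb'.
have eb : b = b'.
  apply: eqn_from_log => // p.
  have := congr1 (logn p) e.
  rewrite !lognM ?expn_gt0 ?m0 ?m0' // ?lognX.
  have := logn_squarefree p sb; have := logn_squarefree p sb'; lia.
split=> //; move: e; rewrite eb => /eqP.
by rewrite eqn_pmul2r // eqn_exp2r // => /eqP.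
Qed.

(** If [n = m ^ 2 * b] with [b] squarefree, then [b] divides [m], because an odd
    exponent that is at least 2 is at least 3. *)
Lemma squarefull_decomposition n : squarefull n ->
  exists a b, [/\ (0 < a)%N, squarefree b & n = (a ^ 2 * b ^ 3)%N].
Proof.
case/andP=> n0 /allP sq.
have [m [b [m0 sb nE]]] := squarefree_part_exists n0.
have b0 := squarefree_gt0 sb.
have bm : (b %| m)%N.
  apply/dvdn_partP => // p pb; rewrite p_part.
  have [pp _ pdb] : [/\ prime p, (0 < b)%N & (p %| b)%N].
    by move: pb; rewrite mem_primes => /and3P[].
  rewrite pfactor_dvdn //.
  have pn : p \in primes n by rewrite mem_primes pp n0 nE dvdn_mull.
  have := sq p pn; rewrite pfactor_dvdn // nE lognM ?expn_gt0 ?m0 // ?lognX.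
  have := logn_squarefree p sb; lia.
case/dvdnP: bm => a mE; exists a, b; split=> //.
  by move: m0; rewrite mE muln_gt0 => /andP[].
rewrite nE mE expnMn; ring.
Qed.

Lemma squarefull_sqr_cube a b : (0 < a)%N -> (0 < b)%N -> squarefull (a ^ 2 * b ^ 3).
Proof.
move=> a0 b0; have n0 : (0 < a ^ 2 * b ^ 3)%N by rewrite muln_gt0 !expn_gt0 a0 b0.
rewrite /squarefull n0 /=; apply/allP => p; rewrite mem_primes => /and3P[pp _].
rewrite Euclid_dvdM // !Euclid_dvdX // => /orP[] /andP[pd _].
  by apply: dvdn_mulr; rewrite dvdn_exp2r.
by apply: dvdn_mull; rewrite (expnS b) dvdn_mull // dvdn_exp2r.
Qed.

Lemma squarefull_decomposition_uniq a a' b b' : (0 < a)%N -> (0 < a')%N ->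
  squarefree b -> squarefree b' -> (a ^ 2 * b ^ 3 = a' ^ 2 * b' ^ 3)%N -> a = a' /\ b = b'.
Proof.
move=> a0 a0' sb sb' e.
have b0 := squarefree_gt0 sb; have b0' := squarefree_gt0 sb'.
have E c d : ((c * d) ^ 2 * d = c ^ 2 * d ^ 3)%N by rewrite expnMn (expnSr d 2) mulnA.
have [] := @squarefree_part_uniq (a * b) (a' * b') b b'; rewrite ?muln_gt0 ?a0 ?a0' //.
  by rewrite !E.
by move=> + eb; rewrite eb => /eqP; rewrite eqn_pmul2r // => /eqP.
Qed.

Lemma sqr_cube_leq a b : (0 < a)%N -> (0 < b)%N ->
  (a <= a ^ 2 * b ^ 3)%N && (b <= a ^ 2 * b ^ 3)%N.
Proof.
move=> a0 b0; apply/andP; split.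
  by rewrite -mulnn -mulnA leq_pmulr // muln_gt0 a0 expn_gt0 b0.
by rewrite (expnSr b) mulnA leq_pmull // muln_gt0 !expn_gt0 a0 b0.
Qed.

Lemma squarefull_count_sum (R : realType) (M : nat) (z : R) :
  (Num.truncn z < M)%N ->
  squarefull_count z =
  (\sum_(b < M | squarefree b) \sum_(a < M | (0 < a) && (a ^ 2 * b ^ 3 <= Num.truncn z)) 1)%N.
Proof.
rewrite /squarefull_count; set T := Num.truncn z => TM.
rewrite -sum1_count.
rewrite (_ : iota 1 T = index_iota 1 T.+1); last by rewrite /index_iota subn1.
rewrite big_mkcond /=.
under [RHS]eq_bigr => b _ do rewrite big_mkcond /=.
rewrite [RHS]big_mkcond /=.
transitivity (\sum_(1 <= n < T.+1) \sum_(b < M) \sum_(a < M)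
   ([&& squarefree b, (0 < a)%N & (n == a ^ 2 * b ^ 3)%N] : nat))%N.
  apply: eq_big_nat => n /andP[n1 nT]; case: ifPn => sn.
    have [a [b [a0 sb nE]]] := squarefull_decomposition sn.
    have /andP[an bn] := sqr_cube_leq a0 (squarefree_gt0 sb).
    have aM : (a < M)%N by move: an; rewrite -nE; lia.
    have bM : (b < M)%N by move: bn; rewrite -nE; lia.
    rewrite (bigD1 (Ordinal bM)) //= (bigD1 (Ordinal aM)) //= sb a0 nE eqxx /=.
    rewrite !big1 //.
      move=> b' bb'; apply: big1 => a' _; apply/eqP; rewrite eqb0; apply/negP.
      case/and3P=> sb' a0' /eqP /esym/squarefull_decomposition_uniq[] // _ e.
      by move/eqP: bb'; apply; apply: val_inj.
    move=> a' aa'; apply/eqP; rewrite eqb0; apply/negP.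
    case/andP=> a0' /eqP /esym/squarefull_decomposition_uniq[] // e _.
    by move/eqP: aa'; apply; apply: val_inj.
  symmetry; apply: big1 => b _; apply: big1 => a _; apply/eqP; rewrite eqb0.
  apply/negP; case/and3P=> sb a0 /eqP nE; case/negP: sn; rewrite nE.
  by apply: squarefull_sqr_cube => //; apply: squarefree_gt0.
rewrite exchange_big /=; apply: eq_bigr => b _; rewrite exchange_big /=.
case: ifPn => sb; last by rewrite big1 // => a _; rewrite big1.
apply: eq_bigr => a _; case: ifPn => /=.
  case/andP=> a0 le; rewrite (big_cat_nat _ (n := (a ^ 2 * b ^ 3)%N)) /=; last 2 first.
  - by rewrite muln_gt0 !expn_gt0 a0 (squarefree_gt0 sb).
  - by rewrite (leq_trans le).
  rewrite big_nat big1 => [|n /andP[n1 n2]]; last first.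
    by apply/eqP; rewrite eqb0 a0 /=; apply/eqP; lia.
  rewrite big_ltn // a0 eqxx big_nat big1 // => n /andP[n1 n2].
  by apply/eqP; rewrite eqb0; apply/eqP; lia.
case: (posnP a) => //= [_ _|a0 le]; first by rewrite big1.
rewrite big_nat big1 // => n /andP[n1 n2]; apply/eqP; rewrite eqb0; apply/eqP; lia.
Qed.

(** * The power 3/2 and the constant of the main term *)

Definition pow32 (R : realType) (x : R) : R := x * Num.sqrt x.

Lemma pow32_powR (R : realType) (x : R) : 0 <= x -> x `^ (3%:R / 2%:R) = pow32 x.
Proof.
move=> x0; have [->|xn0] := eqVneq x 0; first by rewrite /pow32 mul0r powR0 //; lra.
have -> : 3%:R / 2%:R = 1 + 2^-1 :> R by lra.
by rewrite powRD ?xn0 ?implybT // powRr1 // powR12_sqrt.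
Qed.

Lemma pow32_sqr (R : realType) (x : R) : 0 <= x -> pow32 (x ^+ 2) = x ^+ 3.
Proof. by move=> x0; rewrite /pow32 sqrtr_sqr ger0_norm // -exprSr. Qed.

Lemma pow32_gt0 (R : realType) (x : R) : 0 < x -> 0 < pow32 x.
Proof. by move=> x0; rewrite mulr_gt0 ?sqrtr_gt0. Qed.

Lemma pow32_ge0 (R : realType) (x : R) : 0 <= x -> 0 <= pow32 x.
Proof. by move=> x0; rewrite mulr_ge0 ?sqrtr_ge0. Qed.

Lemma pow32_le (R : realType) (x y : R) : 0 <= x -> x <= y -> pow32 x <= pow32 y.
Proof.
move=> x0 xy; have y0 := le_trans x0 xy.
by apply: ler_pM => //; rewrite ?sqrtr_ge0 ?ler_sqrt.
Qed.

Lemma pow32M (R : realType) (x y : R) : 0 <= x -> pow32 (x * y) = pow32 x * pow32 y.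
Proof. by move=> x0; rewrite /pow32 sqrtrM // mulrACA. Qed.

Lemma sqr_pow32 (R : realType) (x : R) : 0 <= x -> pow32 x ^+ 2 = x ^+ 3.
Proof. by move=> x0; rewrite exprMn sqr_sqrtr // -exprSr. Qed.

(** Comparison with the telescoping sequence [2 / Num.sqrt n]. *)
Lemma pow32_tail (R : realType) (N M : nat) : (0 < N)%N ->
  \sum_(N.+1 <= n < M) (pow32 n%:R)^-1 <= 2%:R / Num.sqrt N%:R :> R.
Proof.
move=> N0; have [MN|NM] := leqP M N.+1.
  by rewrite big_geq // divr_ge0 ?sqrtr_ge0.
suff main k : \sum_(N.+1 <= n < N.+1 + k) (pow32 n%:R)^-1 <=
   2%:R / Num.sqrt N%:R - 2%:R / Num.sqrt (N + k)%:R :> R.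
  have := main (M - N.+1)%N; rewrite subnKC ?(ltnW NM) // => /le_trans; apply.
  by rewrite gerBl divr_ge0 ?sqrtr_ge0.
elim: k => [|k IH]; first by rewrite addn0 big_geq // addn0 subrr.
rewrite addnS big_nat_recr /= ?leq_addr //.
apply: le_trans (lerD IH (lexx _)) _.
rewrite addnS addSn; have : (0 < N + k)%N by lia.
move: (N + k)%N => {IH}k k0; rewrite /pow32.
set t := Num.sqrt k.+1%:R; set s := Num.sqrt k%:R.
have s0 : 0 < s by rewrite sqrtr_gt0 ltr0n.
have t0 : 0 < t by rewrite sqrtr_gt0 ltr0n.
have st : s <= t by rewrite ler_sqrt ?ler0n // ler_nat.
have t2 : k.+1%:R = t ^+ 2 by rewrite sqr_sqrtr ?ler0n.
have e : t ^+ 2 = s ^+ 2 + 1 by rewrite -t2 -natr1 sqr_sqrtr ?ler0n.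
rewrite t2; move: (Num.sqrt N%:R) => r; move: s t s0 t0 st {t2} e => s t s0 t0 st e.
rewrite -subr_ge0.
have -> : 2 / r - 2 / t - (2 / r - 2 / s + (t ^+ 2 * t)^-1) =
   (2 * t ^+ 2 * (t - s) - s) / (s * t ^+ 3).
  by move: (r^-1) => q; field; rewrite !gt_eqF.
apply: divr_ge0; last by rewrite mulr_ge0 ?exprn_ge0 ?ltW.
have h : (t - s) * (t + s) = 1 by rewrite -subr_sqr e; ring.
have h1 : (t - s) * (t + s) <= (t - s) * (2 * t) by rewrite ler_wpM2l ?subr_ge0 //; lra.
rewrite h in h1; nra.
Qed.

Lemma bigop_ord_gt0 (R : Type) (idx : R) (op : Monoid.law idx) N (F : nat -> R) :
  \big[op/idx]_(1 <= n < N) F n = \big[op/idx]_(n < N | (0 < n)%N) F n.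
Proof. by rewrite big_geq_mkord. Qed.

Lemma square_part_count_le1 (B N n : nat) :
  (\sum_(b < B | squarefree b) \sum_(m < N | (0 < m)%N) (n == m ^ 2 * b)%N <= 1)%N.
Proof.
rewrite pair_big_dep /=.
case: (pickP (fun i : 'I_B * 'I_N => [&& squarefree i.1, (0 < i.2)%N & (n == i.2 ^ 2 * i.1)%N])).
  move=> [b m] /and3P[/= sb m0 /eqP nE].
  rewrite (bigD1 (b, m)) ?sb ?m0 //= nE eqxx big1 // => -[b' m'] /= /andP[/andP[sb' m0'] ne].
  apply/eqP; rewrite eqb0; apply: contra ne => /eqP /squarefree_part_uniq[] // e1 e2.
  by rewrite xpair_eqE; apply/andP; split; apply/eqP/val_inj.
move=> nope; rewrite big1 // => i /andP[sb m0]; apply/eqP; rewrite eqb0.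
by have := nope i; rewrite sb m0 /= => ->.
Qed.

Lemma square_part_count_ge1 (N n : nat) : (0 < n < N)%N ->
  (1 <= \sum_(b < N | squarefree b) \sum_(m < N | (0 < m)%N) (n == m ^ 2 * b)%N)%N.
Proof.
move=> /andP[n0 nN]; have [m [b [m0 sb nE]]] := squarefree_part_exists n0.
have mN : (m < N)%N by apply: leq_ltn_trans nN;
  rewrite nE -mulnn -mulnA leq_pmulr // muln_gt0 m0 squarefree_gt0.
have bN : (b < N)%N by apply: leq_ltn_trans nN; rewrite nE leq_pmull // expn_gt0 m0.
rewrite (bigD1 (Ordinal bN)) //= (bigD1 (Ordinal mN)) //= -nE eqxx.
lia.
Qed.

(** Each [n < N] occurs among the [m ^ 2 * b] with [b, m < N]. *)
Lemma zeta_pow32_le (R : realType) (N : nat) :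
  \sum_(n < N | (0 < n)%N) (pow32 n%:R)^-1 <=
  (\sum_(b < N | squarefree b) (pow32 b%:R)^-1) * (\sum_(m < N | (0 < m)%N) (m%:R ^+ 3)^-1) :> R.
Proof.
rewrite big_distrlr /=.
have -> : \sum_(b < N | squarefree b) \sum_(m < N | (0 < m)%N) (pow32 b%:R)^-1 * (m%:R ^+ 3)^-1 =
  \sum_(b < N | squarefree b) \sum_(m < N | (0 < m)%N) (pow32 (m ^ 2 * b)%:R)^-1 :> R.
  apply: eq_bigr => b _; apply: eq_bigr => m _.
  by rewrite natrM natrX pow32M ?exprn_ge0 ?ler0n // pow32_sqr ?ler0n // [RHS]invfM mulrC.
apply: (@le_trans _ _ ((\sum_(n < N | (0 < n)%N) (pow32 n%:R)^-1 *
   (\sum_(b < N | squarefree b) \sum_(m < N | (0 < m)%N) (n == m ^ 2 * b :> nat)%N)%:R) : R)).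
  apply: ler_sum => n n0; apply: ler_peMr; first by rewrite invr_ge0 pow32_ge0 ?ler0n.
  by rewrite ler1n square_part_count_ge1 // n0 ltn_ord.
under eq_bigr => n _ do rewrite natr_sum mulr_sumr.
rewrite exchange_big /=; apply: ler_sum => b sb.
under eq_bigr => n _ do rewrite natr_sum mulr_sumr.
rewrite exchange_big /=; apply: ler_sum => m m0.
have [lt|ge] := ltnP (m ^ 2 * b) N.
  rewrite (bigD1 (Ordinal lt)) /=; last by rewrite muln_gt0 expn_gt0 m0 squarefree_gt0.
  rewrite eqxx mulr1 big1 ?addr0 // => n /andP[_ ne].
  rewrite (_ : (_ == _) = false) ?mulr0 //; apply: contraNF ne => /eqP e.
  by apply/eqP/val_inj.
rewrite big1 => [|n _]; first by rewrite invr_ge0 pow32_ge0 ?ler0n.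
by rewrite (_ : (_ == _) = false) ?mulr0 //; apply/eqP; have := ltn_ord n; lia.
Qed.

(** The [m ^ 2 * b] are distinct. *)
Lemma zeta_pow32_ge (R : realType) (B N : nat) : exists K : nat,
  (\sum_(b < B | squarefree b) (pow32 b%:R)^-1) * (\sum_(m < N | (0 < m)%N) (m%:R ^+ 3)^-1)
  <= \sum_(n < K | (0 < n)%N) (pow32 n%:R)^-1 :> R.
Proof.
exists (N ^ 2 * B)%N; set K := (N ^ 2 * B)%N.
rewrite big_distrlr /=.
have -> : \sum_(b < B | squarefree b) \sum_(m < N | (0 < m)%N) (pow32 b%:R)^-1 * (m%:R ^+ 3)^-1 =
  \sum_(b < B | squarefree b) \sum_(m < N | (0 < m)%N) \sum_(n < K | (0 < n)%N)
     (pow32 n%:R)^-1 * (n == m ^ 2 * b :> nat)%N%:R :> R.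
  apply: eq_bigr => b sb; apply: eq_bigr => m m0.
  have lt : (m ^ 2 * b < K)%N.
    rewrite /K (@leq_ltn_trans (N ^ 2 * b)) ?ltn_pmul2l ?leq_mul2r ?leq_exp2r ?ltn_ord ?orbT //.
    - by rewrite (ltnW (ltn_ord m)) orbT.
    - by rewrite expn_gt0 (leq_trans m0 (ltnW (ltn_ord m))).
  rewrite (bigD1 (Ordinal lt)) /=; last by rewrite muln_gt0 expn_gt0 m0 squarefree_gt0.
  rewrite eqxx mulr1 big1 ?addr0 => [|n /andP[_ ne]].
    by rewrite natrM natrX pow32M ?exprn_ge0 ?ler0n // pow32_sqr ?ler0n // [RHS]invfM mulrC.
  rewrite (_ : (_ == _) = false) ?mulr0 //; apply: contraNF ne => /eqP e.
  by apply/eqP/val_inj.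
under [leLHS]eq_bigr => b _ do rewrite exchange_big /=.
rewrite exchange_big /=; apply: ler_sum => n n0.
under eq_bigr => b _ do rewrite -mulr_sumr -natr_sum.
rewrite -mulr_sumr -natr_sum; apply: ler_piMr; first by rewrite invr_ge0 pow32_ge0 ?ler0n.
by rewrite -[leRHS]/(1%:R) ler_nat square_part_count_le1.
Qed.

Lemma ler_sum_subpred (R : numDomainType) (I : Type) (r : seq I) (P Q : pred I) (f : I -> R) :
  (forall i, P i -> Q i) -> (forall i, 0 <= f i) ->
  \sum_(i <- r | P i) f i <= \sum_(i <- r | Q i) f i.
Proof.
move=> PQ f0; rewrite big_mkcond [leRHS]big_mkcond; apply: ler_sum => i _.
by have := PQ i; case: (P i) => [->|_] //; case: (Q i).
Qed.

Lemma nneg_series_bounds (R : realType) (f : nat -> R) (K : R) :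
  (forall n, 0 <= f n) -> (forall N, \sum_(1 <= n < N) f n <= K) ->
  (forall N, \sum_(1 <= n < N) f n <= \big[+%R/0]_(1 <= n <oo) f n) /\
  \big[+%R/0]_(1 <= n <oo) f n <= K.
Proof.
move=> f0 fK.
have mono : {homo (fun N => \sum_(1 <= n < N) f n) : n m / (n <= m)%N >-> n <= m}.
  by move=> m n mn; rewrite !bigop_ord_gt0 (big_ord_widen_cond n) // ler_sum_subpred // => i /andP[].
have cv : cvgn (fun N => \sum_(1 <= n < N) f n).
  by apply: nondecreasing_is_cvgn => //; exists K => _ [N _ <-].
split; first by move=> N; apply: nondecreasing_cvgn_le.
by apply: limr_le => //; apply: nearW.
Qed.

Lemma zeta32E (R : realType) :
  zeta (3%:R / 2%:R) = \big[+%R/0]_(1 <= n <oo) (pow32 n%:R)^-1 :> R.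
Proof.
by rewrite /zeta; under eq_fun do under eq_bigr => n _ do rewrite pow32_powR ?ler0n //.
Qed.

Lemma zeta3E (R : realType) :
  zeta 3%:R = \big[+%R/0]_(1 <= n <oo) ((n%:R : R) ^+ 3)^-1.
Proof.
by rewrite /zeta; under eq_fun do under eq_bigr => n _ do rewrite powR_mulrn ?ler0n //.
Qed.

Lemma pow32_sum_le (R : realType) (N : nat) : \sum_(1 <= n < N) (pow32 n%:R)^-1 <= 3%:R :> R.
Proof.
have [N1|N1] := leqP N 1; first by rewrite big_geq.
rewrite big_ltn // {1}/pow32 sqrtr1 mulr1 invr1.
by have := @pow32_tail R 1 N isT; rewrite sqrtr1; lra.
Qed.

Lemma cube_le_pow32 (R : realType) (n : nat) : (n%:R ^+ 3)^-1 <= (pow32 n%:R)^-1 :> R.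
Proof.
case: n => [|n]; first by rewrite /pow32 !mul0r expr0n.
have n1 : 1 <= n.+1%:R :> R by rewrite ler1n.
rewrite lef_pV2 ?posrE ?exprn_gt0 ?pow32_gt0 ?ltr0n //.
rewrite exprS ler_wpM2l ?ler0n // -[leRHS]ger0_norm ?exprn_ge0 // -sqrtr_sqr ler_sqrt ?exprn_ge0 //.
by rewrite -exprM ler_eXnr.
Qed.

(** The unique writing [n = m ^ 2 * b] factors [zeta (3/2)] as [zeta 3] times the
    sum of [b ^ (-3/2)] over squarefree [b].  On partial sums it gives an
    inequality in each direction, so the limits can be taken separately. *)
Lemma zeta_ratio (R : realType) (B : nat) : (0 < B)%N ->
  `|zeta (3%:R / 2%:R) / zeta 3%:R - \sum_(b < B.+1 | squarefree b) (pow32 b%:R)^-1|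
  <= 2%:R / Num.sqrt B%:R :> R.
Proof.
move=> B0; rewrite zeta32E zeta3E.
have z32_ge0 n : 0 <= (pow32 n%:R)^-1 :> R by rewrite invr_ge0 pow32_ge0 ?ler0n.
have z3_ge0 n : 0 <= (n%:R ^+ 3)^-1 :> R by rewrite invr_ge0 exprn_ge0 ?ler0n.
have [lo32 _] := nneg_series_bounds z32_ge0 (@pow32_sum_le R).
have b3 N : \sum_(1 <= n < N) (n%:R ^+ 3)^-1 <= 3%:R :> R.
  by apply: le_trans (pow32_sum_le R N); apply: ler_sum => n _; apply: cube_le_pow32.
have [lo3 _] := nneg_series_bounds z3_ge0 b3.
set Z32 := \big[+%R/0]_(1 <= n <oo) (pow32 n%:R)^-1 in lo32 *.
set Z3 := \big[+%R/0]_(1 <= n <oo) _ in lo3 *.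
have Z3_gt0 : 0 < Z3.
  apply: lt_le_trans (lo3 2); rewrite big_nat1 expr1n invr1; exact: ltr01.
set S := \sum_(b < B.+1 | _) _.
have SN N : \sum_(b < N | squarefree b) (pow32 b%:R)^-1 <= S + 2%:R / Num.sqrt B%:R :> R.
  have [le|lt] := leqP N B.+1.
    apply: (@le_trans _ _ S); last by rewrite lerDl divr_ge0 ?sqrtr_ge0.
    rewrite (big_ord_widen_cond B.+1 (fun b => squarefree b) (fun b => (pow32 b%:R)^-1)) //.
    by apply: ler_sum_subpred => // i /andP[].
  apply: (@le_trans _ _ (S + \sum_(B.+1 <= n < N) (pow32 n%:R)^-1)); last first.
    by rewrite lerD2l pow32_tail.
  rewrite /S -!(big_mkord squarefree (fun b => (pow32 b%:R)^-1)).
  rewrite (big_cat_nat _ (n := B.+1)) ?(ltnW lt) //= lerD2l.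
  by rewrite big_mkcond; apply: ler_sum => i _; case: ifP.
have up : Z32 <= (S + 2%:R / Num.sqrt B%:R) * Z3.
  rewrite /Z32; apply: (nneg_series_bounds z32_ge0 _).2 => N.
  rewrite bigop_ord_gt0; apply: le_trans (@zeta_pow32_le R N) _.
  apply: ler_pM; [exact: sumr_ge0 | exact: sumr_ge0 | exact: SN |].
  by rewrite -(bigop_ord_gt0 _ _ (fun m => (m%:R ^+ 3)^-1)).
have lo : S * Z3 <= Z32.
  have S0 : 0 < S.
    have h1 : (1 < B.+1)%N by lia.
    rewrite /S (bigD1 (Ordinal h1)) //= ltr_pwDl ?sumr_ge0 //.
    by rewrite invr_gt0 pow32_gt0.
  rewrite mulrC -ler_pdivlMr //; apply: (nneg_series_bounds z3_ge0 _).2 => N.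
  rewrite ler_pdivlMr // mulrC; have [K le] := zeta_pow32_ge R B.+1 N.
  by rewrite bigop_ord_gt0; apply: le_trans le _; rewrite -(bigop_ord_gt0 _ _ (fun m => (pow32 m%:R)^-1)).
rewrite ler_norml; apply/andP; split.
  by rewrite lerBrDr ler_pdivlMr // (le_trans _ lo) // ler_wpM2r ?(ltW Z3_gt0) //
    gerDr oppr_le0 divr_ge0 ?sqrtr_ge0.
by rewrite lerBlDr ler_pdivrMr // addrC.
Qed.

(** * The main term *)

Lemma sin_le_id (R : realType) (x : R) : 0 <= x -> sin x <= x.
Proof.
move=> x0; have [|c _] := @MVT_segment R sin cos 0 x x0.
  by apply: continuous_subspaceT => y; apply: continuous_sin.
rewrite sin0 !subr0 => ->; rewrite ler_piMl //; exact: cos_le1.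
Qed.

Lemma normr_sin_le (R : realType) (x : R) : 0 <= x -> `|sin x| <= x.
Proof.
move=> x0; rewrite ler_norml sin_le_id // andbT.
have [x1|x1] := leP x 1; last first.
  by apply: (@le_trans _ _ (-1)); [lra|exact: sin_geN1].
apply: (@le_trans _ _ 0); first by lra.
apply: sin_ge0_pi; rewrite x0 /=; have := pi_ge2 R; lra.
Qed.

Lemma sinc_sqr_le (R : realType) (v : R) : 0 < v -> sinc v ^+ 2 <= 4%:R / (1 + v) ^+ 2.
Proof.
move=> v0; rewrite /sinc gt_eqF //.
have pv : 0 < pi * v by rewrite mulr_gt0 // pi_gt0.
have v1 : 0 < (1 + v) ^+ 2 by rewrite exprn_gt0 //; lra.
have p2 := pi_ge2 R.
have n0 : 0 <= `|sin (pi * v)| by [].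
have s1 := sin_max (pi * v).
have s2 := normr_sin_le (ltW pv).
rewrite expr_div_n -(@real_normK _ (sin _)) ?num_real // ler_pdivlMr // mulrAC ler_pdivrMr ?exprn_gt0 //.
move: (`|sin _|) n0 s1 s2 => s n0 s1 s2.
have e1 : s * v <= v by rewrite -[leRHS]mul1r ler_wpM2r // ltW.
have e2 : v <= pi * v by rewrite ler_peMl ?(ltW v0) //; lra.
have e3 : s * (1 + v) <= 2 * (pi * v) by rewrite mulrDr mulr1; lra.
rewrite -exprMn (_ : 4 = 2 ^+ 2); last by rewrite -natrX.
rewrite -exprMn ler_sqr ?nnegrE //; [by rewrite mulr_ge0 // addr_ge0 // ltW | by rewrite mulr_ge0 // ltW].
Qed.

(** The sum of [(1 + v) ^ -2] over the multiples [v] of [t] is compared with the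
    telescoping sum of the differences of [1 / (1 + v)], divided by [t]. *)
Lemma sinc_sum_le (R : realType) (t : R) : 0 < t ->
  0 <= \big[+%R/0]_(1 <= n <oo) sinc (n%:R * t) ^+ 2 <= 4%:R / t.
Proof.
move=> t0; have f0 n : 0 <= sinc (n%:R * t) ^+ 2 by apply: sqr_ge0.
have part N : \sum_(1 <= n < N) sinc (n%:R * t) ^+ 2 <= 4%:R / t.
  have [N0|N0] := leqP N 1; first by rewrite big_geq // divr_ge0 // ltW.
  suff main k : \sum_(1 <= n < k.+1) sinc (n%:R * t) ^+ 2 <= 4%:R / t * (1 - (1 + k%:R * t)^-1).
    rewrite -(prednK (ltnW N0)); apply: le_trans (main _) _.
    apply: ler_piMr; first by rewrite divr_ge0 // ltW.
    by rewrite gerBl invr_ge0 addr_ge0 // mulr_ge0 // ltW.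
  elim: k => [|k IH]; first by rewrite big_geq // mul0r addr0 invr1 subrr mulr0.
  rewrite big_nat_recr //=; apply: le_trans (lerD IH (sinc_sqr_le _)) _.
    by rewrite mulr_gt0 // ltr0n.
  have k0 : 0 <= k%:R * t by rewrite mulr_ge0 // ltW.
  have -> : k.+1%:R * t = k%:R * t + t by rewrite -(natr1 k) mulrDl mul1r.
  move: (k%:R * t) k0 => a a0; rewrite -subr_ge0.
  have -> : 4 / t * (1 - (1 + (a + t))^-1) - (4 / t * (1 - (1 + a)^-1) + 4 / (1 + (a + t)) ^+ 2) =
     4 * t / ((1 + a) * (1 + (a + t)) ^+ 2).
    by field; rewrite !gt_eqF //; lra.
  by rewrite divr_ge0 ?mulr_ge0 ?exprn_ge0 //; lra.
have [lo hi] := nneg_series_bounds f0 part.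
by rewrite hi (le_trans _ (lo 0%N)) // big_geq.
Qed.

(** * Counting pairs of close fractions *)

Lemma harmonic_le (R : realType) (M : nat) : (0 < M)%N ->
  \sum_(n < M | (0 < n)%N) n%:R^-1 <= 1 + ln M%:R :> R.
Proof.
move=> M0; suff main k : \sum_(1 <= n < k.+2) n%:R^-1 <= 1 + ln k.+1%:R :> R.
  rewrite -(bigop_ord_gt0 _ _ (fun n => n%:R^-1)); case: M M0 => // -[|M] _.
    by rewrite big_geq // ln1 addr0.
  by apply: le_trans (main M) _; rewrite lerD2l ler_ln ?posrE ?ltr0n // ler_nat.
elim: k => [|k IH]; first by rewrite big_nat1 invr1 ln1 addr0.
rewrite big_nat_recr //=; apply: le_trans (lerD IH (lexx _)) _.
rewrite -addrA lerD2l addrC -lerBrDr -ln_div ?posrE ?ltr0n //.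
(* the inequality is [ln (1 - t) <= - t] with [t = 1 / (k + 2)] *)
rewrite -[leRHS]opprK -lnV ?posrE ?divr_gt0 ?ltr0n // invf_div lerNr.
have k2 : 0 < k.+2%:R :> R by rewrite ltr0n.
have -> : k.+1%:R / k.+2%:R = 1 + - k.+2%:R^-1 :> R.
  by rewrite -(natr1 k.+1) in k2 *; field; rewrite gt_eqF.
by apply: le_ln1Dx; rewrite ltrN2 invf_lt1 // ltr1n.
Qed.

(** By induction on [F]: the smallest point [x] can be removed once [c] is
    raised to [f x + w x / K], below which no other point lies. *)
Lemma gap_sum_max (R : realType) (T : finType) (f w : T -> R) (K : R) (m : T) :
  0 < K -> forall (n : nat) (F : {set T}) (c : R), #|F| = n -> m \in F ->
  (forall x, x \in F -> c <= f x <= f m) ->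
  (forall x y, x \in F -> y \in F -> x != y -> w x <= K * `|f x - f y|) ->
  \sum_(x in F | x != m) w x <= K * (f m - c).
Proof.
move=> K0; elim=> [|n IH] F c Fn mF cF gap.
  by move: mF; rewrite (cards0_eq Fn) inE.
have [/existsP[y0 /andP[y0F y0m]]|no] := boolP [exists y in F, y != m]; last first.
  rewrite big1 => [|x /andP[xF xm]]; last first.
    by case/existsP: no; exists x; rewrite xF xm.
  by rewrite mulr_ge0 ?subr_ge0 ?(ltW K0) //; case/andP: (cF m mF).
pose P y := (y \in F) && (y != m).
have P0 : P y0 by rewrite /P y0F y0m.
case: (@arg_minP _ _ _ y0 P f P0) => x1 /andP[x1F x1m] x1min.
have cx1 : c <= f x1 by case/andP: (cF x1 x1F).
rewrite (bigD1 x1) ?x1F ?x1m //=.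
rewrite (eq_bigl (fun x => (x \in F :\ x1) && (x != m))); last first.
  by move=> x; rewrite !inE; case: (x == x1); case: (x == m); case: (x \in F).
have := IH (F :\ x1) (f x1 + w x1 / K).
rewrite (cardsD1 x1) x1F add1n in Fn; case: Fn => Fn /(_ Fn).
rewrite !inE eq_sym x1m mF => /(_ isT) H.
apply: le_trans (lerD (lexx _) (H _ _)) _.
- move=> x; rewrite !inE => /andP[xx1 xF]; case/andP: (cF x xF) => _ ->; rewrite andbT.
  have x1x : f x1 <= f x.
    have [->|xm] := eqVneq x m; first by case/andP: (cF x1 x1F).
    by apply: x1min; rewrite /P xF xm.
  have := gap x1 x x1F xF; rewrite eq_sym => /(_ xx1).
  rewrite distrC ger0_norm ?subr_ge0 // mulrC -ler_pdivrMr //; lra.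
- by move=> x y; rewrite !inE => /andP[_ xF] /andP[_ yF]; apply: gap.
have -> : w x1 + K * (f m - (f x1 + w x1 / K)) = K * (f m - f x1).
  by field; rewrite gt_eqF.
by rewrite ler_wpM2l ?(ltW K0) // lerD2l lerN2.
Qed.

(** The points lie in an interval of length [D], and each weight is at most [K]
    times the gap to the right of its point; only the last point has none. *)
Lemma gap_sum (R : realType) (T : finType) (P : pred T) (f w : T -> R) (K D : R) (t0 : T) :
  0 < K -> 0 <= D ->
  (forall x y, P x -> P y -> x != y -> w x <= K * `|f x - f y|) ->
  (forall x y, P x -> P y -> `|f x - f y| <= D) ->
  exists m, \sum_(x | P x && (x != m)) w x <= K * D.
Proof.
move=> K0 D0 gap diam.
have [x0 Px0|no] := pickP P; last first.
  exists t0; rewrite big1 ?mulr_ge0 ?(ltW K0) // => x /andP[Px _].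
  by rewrite no in Px.
case: (@arg_maxP _ _ _ x0 P f Px0) => m Pm mmax.
case: (@arg_minP _ _ _ x0 P f Px0) => l Pl lmin.
exists m; apply: le_trans (_ : _ <= K * (f m - f l)) _; last first.
  by rewrite ler_wpM2l ?(ltW K0) // (le_trans (ler_norm _)) ?diam.
have := @gap_sum_max R T f w K m K0 _ [set x | P x] (f l) erefl.
rewrite (eq_bigl (fun x => P x && (x != m))); last by move=> x; rewrite !inE.
apply.
- by rewrite inE.
- by move=> x; rewrite inE => Px; rewrite lmin //=; apply: mmax.
- by move=> x y; rewrite !inE; apply: gap.
Qed.

(** The edges outside the two exceptional maps are summed along one side; the
    others form a partial matching, where [u * v <= (u ^ 2 + v ^ 2) / 2]. *)
Lemma bilinear_matching (R : realType) (T1 T2 : finType) (E : T1 -> T2 -> bool)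
    (w1 : T1 -> R) (w2 : T2 -> R) (g1 : T2 -> T1) (g2 : T1 -> T2) (a b : R) :
  (forall r, 0 <= w1 r) -> (forall s, 0 <= w2 s) ->
  (forall s, \sum_(r | E r s && (r != g1 s)) w1 r <= a) ->
  (forall r, \sum_(s | E r s && (s != g2 r)) w2 s <= b) ->
  \sum_r \sum_(s | E r s) w1 r * w2 s <=
  a * \sum_s w2 s + b * \sum_r w1 r + (\sum_r w1 r ^+ 2 + \sum_s w2 s ^+ 2) / 2%:R.
Proof.
move=> w10 w20 ha hb.
apply: (@le_trans _ _ (\sum_r \sum_s
   ((if E r s && (r != g1 s) then w1 r * w2 s else 0)
    + (if E r s && (s != g2 r) then w2 s * w1 r else 0)
    + ((if s == g2 r then w1 r ^+ 2 / 2%:R else 0)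
       + (if r == g1 s then w2 s ^+ 2 / 2%:R else 0))))).
  apply: ler_sum => r _; rewrite big_mkcond /=; apply: ler_sum => s _.
  have p0 : 0 <= w1 r * w2 s by rewrite mulr_ge0.
  have q1 : 0 <= w1 r ^+ 2 / 2%:R by rewrite divr_ge0 ?sqr_ge0.
  have q2 : 0 <= w2 s ^+ 2 / 2%:R by rewrite divr_ge0 ?sqr_ge0.
  have am : w1 r * w2 s <= w1 r ^+ 2 / 2%:R + w2 s ^+ 2 / 2%:R.
    by have := sqr_ge0 (w1 r - w2 s); rewrite sqrrB; lra.
  by case: (E r s) => /=; case: (r == _); case: (s == _) => /=; rewrite ?(mulrC (w2 s)); lra.
under eq_bigr => r _ do rewrite !big_split /=.
rewrite !big_split /=; apply: lerD; first apply: lerD.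
- rewrite exchange_big /= mulr_sumr; apply: ler_sum => s _.
  by rewrite -big_mkcond /= -mulr_suml ler_wpM2r.
- rewrite mulr_sumr; apply: ler_sum => r _.
  by rewrite -big_mkcond /= -mulr_suml ler_wpM2r.
rewrite mulrDl; apply: lerD.
  by rewrite mulr_suml; apply: ler_sum => r _; rewrite -big_mkcond big_pred1_eq.
rewrite exchange_big /= mulr_suml; apply: ler_sum => s _.
by rewrite -big_mkcond big_pred1_eq.
Qed.

Lemma count_multiples (M T q : nat) : (0 < q)%N ->
  (\sum_(n < M | [&& (0 < n)%N, (n <= T)%N & (q %| n)%N]) 1 <= T %/ q)%N.
Proof.
move=> q0; suff : (\sum_(n < M | [&& (0 < n)%N, (n <= T)%N & (q %| n)%N]) 1 <= minn M.-1 T %/ q)%N.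
  by move=> /leq_trans; apply; apply: leq_div2r; lia.
elim: M => [|M IH]; first by rewrite big_ord0.
rewrite big_mkcond big_ord_recr -big_mkcond /=; case: ifP => [/and3P[M0 MT qM]|_]; last first.
  by rewrite addn0 (leq_trans IH) // leq_div2r //; lia.
rewrite (minn_idPl MT); case: M M0 MT qM IH => // M _ MT qM.
by rewrite /= (minn_idPl (ltnW MT)) divnS // qM /= addnC add1n.
Qed.

Lemma count_multiples_le (R : realType) (M q : nat) (N : R) : (0 < q)%N -> 0 <= N ->
  \sum_(n < M | [&& (0 < n)%N, n%:R <= N & (q %| n)%N]) 1 <= N / q%:R.
Proof.
move=> q0 N0; have q0' : 0 < q%:R :> R by rewrite ltr0n.
apply: (@le_trans _ _ (Num.truncn N %/ q)%N%:R).
  rewrite sumr_const ler_nat -sum1_card (leq_trans _ (count_multiples M _ q0)) //.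
  rewrite (eq_bigl (fun n : 'I_M => [&& (0 < n)%N, (n <= Num.truncn N)%N & (q %| n)%N])) // => n.
  by rewrite unfold_in truncn_ge_nat.
rewrite ler_pdivlMr // -natrM (le_trans _ (_ : (Num.truncn N)%:R <= _)) ?truncn_le //.
by rewrite ler_nat leq_trunc_div.
Qed.

(** The bound [k] on the size leaves at most [k * q] numerators for each
    denominator [q]. *)
Definition reduced (R : realType) (N : R) (k M : nat) (r : 'I_M * 'I_M) : bool :=
  [&& coprime r.1 r.2, (0 < r.1)%N, (0 < r.2)%N, r.2%:R <= N & (r.1 <= k * r.2)%N].

Definition slope (R : realType) (M : nat) (r : 'I_M * 'I_M) : R := r.1%:R / r.2%:R.

Lemma reduced_gap (R : realType) (N : R) (k M : nat) (r s : 'I_M * 'I_M) :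
  reduced N k r -> reduced N k s -> r != s ->
  (r.2%:R)^-1 <= N * `|slope R r - slope R s|.
Proof.
case: r s => [p q] [p' q']; rewrite /reduced /slope /=.
case/and5P=> cpq p0 q0 qN _ /and5P[cpq' p0' q0' qN' _] ne.
have q0R : 0 < q%:R :> R by rewrite ltr0n.
have q0R' : 0 < q'%:R :> R by rewrite ltr0n.
have ne1 : (p * q' != p' * q)%N.
  apply: contra ne => /eqP e; rewrite xpair_eqE.
  have qq : (q = q' :> nat)%N.
    apply/eqP; rewrite eqn_dvd; apply/andP; split.
      by rewrite -(Gauss_dvdr _ (n := p)) ?(coprime_sym q) // e dvdn_mull.
    by rewrite -(Gauss_dvdr _ (n := p')) ?(coprime_sym q') // -e dvdn_mull.
  apply/andP; split; apply/eqP/val_inj => //=; apply/eqP.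
  by rewrite -(eqn_pmul2r q0) -e qq.
have d1 : 1 <= `|p%:R * q'%:R - p'%:R * q%:R| :> R.
  rewrite -!natrM; move: ne1; rewrite neq_ltn => /orP[] lt.
    rewrite distrC -natrB ?(ltnW lt) // ger0_norm ?ler0n // ler1n subn_gt0 //.
  by rewrite -natrB ?(ltnW lt) // ger0_norm ?ler0n // ler1n subn_gt0.
have -> : p%:R / q%:R - p'%:R / q'%:R = (p%:R * q'%:R - p'%:R * q%:R) / (q%:R * q'%:R) :> R.
  by field; rewrite !gt_eqF.
rewrite normrM normfV (ger0_norm (ltW (mulr_gt0 q0R q0R'))) invfM.
set d := `|_| in d1 *.
rewrite (_ : N * _ = q%:R^-1 * (d * (N / q'%:R))); last by ring.
rewrite ler_peMr ?invr_ge0 ?ler0n //.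
by rewrite mulr_ege1 // ler_pdivlMr // mul1r.
Qed.

(** Each pair [(a, b)] is a multiple of a reduced one, whose denominator [q] has
    at most [N / q] multiples up to [N]. *)
Lemma sum_fractions_le (R : realType) (N : R) (k M : nat) (F : R -> R) :
  0 <= N -> (forall x, 0 <= F x) ->
  \sum_(a < M | (0 < a)%N) \sum_(b < M | [&& (0 < b)%N, b%:R <= N & (a <= k * b)%N])
     F (a%:R / b%:R)
  <= \sum_(r : 'I_M * 'I_M | reduced N k r) N / r.2%:R * F (slope R r).
Proof.
move=> N0 F0.
apply: (@le_trans _ _ (\sum_(a < M | (0 < a)%N)
   \sum_(b < M | [&& (0 < b)%N, b%:R <= N & (a <= k * b)%N])
   \sum_(r : 'I_M * 'I_M | reduced N k r) ((a * r.2 == b * r.1)%N)%:R * F (slope R r))).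
  apply: ler_sum => a a0; apply: ler_sum => b /and3P[b0 bN ab].
  have g0 : (0 < gcdn a b)%N by rewrite gcdn_gt0 a0.
  have [p pE] := dvdnP (dvdn_gcdl a b); have [q qE] := dvdnP (dvdn_gcdr a b).
  have p0 : (0 < p)%N by move: a0; rewrite pE muln_gt0 => /andP[].
  have q0 : (0 < q)%N by move: b0; rewrite qE muln_gt0 => /andP[].
  have pM : (p < M)%N by apply: leq_ltn_trans (ltn_ord a); rewrite pE leq_pmulr.
  have qb : (q <= b)%N by rewrite qE leq_pmulr.
  have qM : (q < M)%N by apply: leq_ltn_trans (ltn_ord b).
  have cpq : coprime p q.
    by rewrite /coprime -(eqn_pmul2r g0) mul1n muln_gcdl -pE -qE.
  rewrite (bigD1 (Ordinal pM, Ordinal qM)) /=; last first.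
    rewrite /reduced /= cpq p0 q0 /= (le_trans _ bN) ?ler_nat //=.
    by rewrite -(leq_pmul2r g0) -mulnA -pE -qE.
  rewrite (_ : (a * q == b * p)%N); last first.
    by rewrite {1}pE {2}qE; apply/eqP; ring.
  rewrite mul1r /slope /= -[leLHS]addr0 lerD ?sumr_ge0 //; last first.
    by move=> r _; rewrite mulr_ge0.
  rewrite (_ : p%:R / q%:R = a%:R / b%:R) //.
  have -> : a%:R = p%:R * (gcdn a b)%:R :> R by rewrite -natrM -pE.
  have -> : b%:R = q%:R * (gcdn a b)%:R :> R by rewrite -natrM -qE.
  by field; rewrite !pnatr_eq0 -!lt0n g0 q0.
under eq_bigr => a _ do rewrite exchange_big /=.
rewrite exchange_big /=; apply: ler_sum => -[p q] /=.
case/and5P=> /= cpq p0 q0 qN _.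
under eq_bigr => a _ do rewrite -mulr_suml.
rewrite -mulr_suml ler_wpM2r //.
apply: le_trans (count_multiples_le M q0 N0).
apply: (@le_trans _ _ (\sum_(b < M | (0 < b)%N && (b%:R <= N)) \sum_(a < M | (0 < a)%N)
    ((a * q == b * p)%N)%:R)).
  rewrite exchange_big /=; apply: ler_sum => a a0.
  by apply: ler_sum_subpred => // b /and3P[-> ->].
rewrite [leRHS](eq_bigl (fun b : 'I_M => ((0 < b)%N && (b%:R <= N)) && (q %| b)%N)); last first.
  by move=> b; rewrite andbA.
rewrite [leRHS]big_mkcondr /=; apply: ler_sum => b _.
have [qb|qb] := boolP (q %| b)%N; last first.
  rewrite big1 // => a _; case: eqP => // e; case/negP: qb.
  by rewrite -(Gauss_dvdl _ (p := p)) ?(coprime_sym q) // -e dvdn_mull.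
have [a0 h0|no] := pickP (fun a : 'I_M => (0 < a)%N && (a * q == b * p)%N).
  have /andP[a00 /eqP e0] : (0 < a0)%N && (a0 * q == b * p)%N := h0.
  rewrite (bigD1 a0) //= e0 eqxx big1 ?addr0 // => a /andP[_ ne].
  case: eqP => // e; case/negP: ne; apply/eqP/val_inj/eqP => /=.
  by rewrite -(eqn_pmul2r q0) e e0.
by rewrite big1 // => a a_; have := no a; rewrite a_ /= => ->.
Qed.

Definition reduced_weight (R : realType) (N : R) (k M : nat) (r : 'I_M * 'I_M) : R :=
  if reduced N k r then r.2%:R^-1 else 0.

Lemma reduced_weight_ge0 (R : realType) (N : R) (k M : nat) (r : 'I_M * 'I_M) :
  0 <= reduced_weight N k r.
Proof. by rewrite /reduced_weight; case: ifP => // _; rewrite invr_ge0. Qed.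

Lemma sum_reduced_le (R : realType) (N : R) (k M : nat) (g : nat -> R) :
  (forall n, 0 <= g n) ->
  \sum_(r : 'I_M * 'I_M | reduced N k r) g r.2
  <= \sum_(q < M | (0 < q)%N && (q%:R <= N)) k%:R * (q%:R * g q).
Proof.
move=> g0; rewrite big_mkcond /= -(pair_bigA _ (fun p q : 'I_M => if reduced N k (p, q) then g q else 0)) /=.
rewrite exchange_big /= [leRHS]big_mkcond /=; apply: ler_sum => q _.
case: ifPn => [/andP[q0 qN]|no]; last first.
  rewrite big1 // => p _; rewrite /reduced /=; case: ifP => // /and5P[_ _ q0 qN _].
  by rewrite q0 qN in no.
rewrite mulrA -natrM.
apply: (@le_trans _ _ (\sum_(p < M | [&& (0 < p)%N, p%:R <= (k * q)%:R :> R & (1 %| p)%N]) 1 * g q)).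
  rewrite [leRHS]big_mkcond /=; apply: ler_sum => p _; rewrite mul1r dvd1n andbT ler_nat /reduced /=.
  by case: ifP => [/and5P[_ -> _ _ ->]|_] //; case: ifP.
by rewrite -mulr_suml ler_wpM2r // (le_trans (count_multiples_le M _ _)) // divr1.
Qed.

Lemma sum_reduced_weight (R : realType) (N : R) (k M : nat) : 0 <= N ->
  \sum_(r : 'I_M * 'I_M) reduced_weight N k r <= k%:R * N.
Proof.
move=> N0; rewrite -big_mkcond /=.
have g0 (q : nat) : 0 <= q%:R^-1 :> R by rewrite invr_ge0.
apply: le_trans (sum_reduced_le N k M g0) _.
rewrite -mulr_sumr ler_wpM2l //.
apply: (@le_trans _ _ (\sum_(q < M | [&& (0 < q)%N, q%:R <= N & (1 %| q)%N]) 1)).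
  rewrite (eq_bigl (fun q : 'I_M => [&& (0 < q)%N, q%:R <= N & (1 %| q)%N])); last first.
    by move=> q; rewrite dvd1n andbT.
  by apply: ler_sum => q /and3P[q0 _ _]; rewrite divff // pnatr_eq0 -lt0n.
by rewrite (le_trans (count_multiples_le M _ _)) // divr1.
Qed.

Lemma sum_reduced_weight_sqr (R : realType) (N : R) (k M : nat) : (0 < M)%N ->
  \sum_(r : 'I_M * 'I_M) reduced_weight N k r ^+ 2 <= k%:R * (1 + ln M%:R).
Proof.
move=> M0.
have -> : \sum_(r : 'I_M * 'I_M) reduced_weight N k r ^+ 2 =
    \sum_(r : 'I_M * 'I_M | reduced N k r) (r.2%:R ^- 2).
  rewrite [RHS]big_mkcond; apply: eq_bigr => r _; rewrite /reduced_weight.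
  by case: ifP => _; rewrite ?exprVn // expr0n.
have g0 (q : nat) : 0 <= q%:R ^- 2 :> R by rewrite invr_ge0 exprn_ge0.
apply: le_trans (sum_reduced_le N k M g0) _.
rewrite -mulr_sumr ler_wpM2l // (le_trans _ (harmonic_le R M0)) //.
apply: (@le_trans _ _ (\sum_(q < M | (0 < q)%N && (q%:R <= N)) q%:R^-1)).
  by apply: ler_sum => q /andP[q0 _]; rewrite expr2 invfM mulrA divff ?mul1r // pnatr_eq0 -lt0n.
by apply: ler_sum_subpred => [q /andP[]|q] //; rewrite invr_ge0.
Qed.

(** The lower bound 1/4 comes from the ratios [b' / b] inside one block. *)
Lemma pow32_expand (R : realType) (x y : R) : 1 <= 4%:R * x -> 1 <= 4%:R * y ->
  `|x - y| <= 2%:R * `|pow32 x - pow32 y|.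
Proof.
wlog xy : x y / x <= y.
  move=> H x1 y1; have [xy|yx] := leP x y; first exact: H.
  by rewrite distrC (distrC (pow32 x)); apply: H => //; apply: ltW.
move=> x1 y1; have x0 : 0 <= x by lra.
have y0 : 0 <= y by lra.
rewrite distrC (distrC (pow32 x)) !ger0_norm ?subr_ge0 ?pow32_le //.
rewrite /pow32; have s1 : 1 <= 2%:R * Num.sqrt y.
  have e : 2%:R = Num.sqrt 4%:R :> R by rewrite (_ : 4%:R = 2%:R ^+ 2) ?sqrtr_sqr ?ger0_norm // -natrX.
  by rewrite e -sqrtrM // -[leLHS]sqrtr1 ler_sqrt // mulr_ge0.
have st : Num.sqrt x <= Num.sqrt y by rewrite ler_sqrt.
have h1 : x * Num.sqrt x <= x * Num.sqrt y by rewrite ler_wpM2l.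
have h2 : (y - x) <= (y - x) * (2%:R * Num.sqrt y) by rewrite ler_peMr ?subr_ge0.
nra.
Qed.

Definition close (R : realType) (d x y : R) : bool :=
  (1 <= 4%:R * y) && (`|x - pow32 y| <= d).

(** The first two terms have the expected order of magnitude
    [d * N1 ^ 2 * N2 ^ 2]; the logarithmic one comes from the pairs of fractions
    that are left out on both sides. *)
Lemma close_fractions_count (R : realType) (N1 N2 d : R) (k1 k2 M : nat) :
  0 < N1 -> 0 < N2 -> 0 <= d -> (0 < M)%N ->
  \sum_(a < M | (0 < a)%N) \sum_(a' < M | [&& (0 < a')%N, a'%:R <= N1 & (a <= k1 * a')%N])
  \sum_(b < M | (0 < b)%N) \sum_(b' < M | [&& (0 < b')%N, b'%:R <= N2 & (b <= k2 * b')%N])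
     (close d (a%:R / a'%:R) (b%:R / b'%:R))%:R
  <= N1 * N2 * (2%:R * d * N1 * (k2%:R * N2) + 4%:R * d * N2 * (k1%:R * N1)
       + (k1 + k2)%:R * (1 + ln M%:R) / 2%:R).
Proof.
move=> N10 N20 d0 M0.
have N10' := ltW N10; have N20' := ltW N20.
pose F (x : R) := \sum_(b < M | (0 < b)%N)
  \sum_(b' < M | [&& (0 < b')%N, b'%:R <= N2 & (b <= k2 * b')%N]) (close d x (b%:R / b'%:R))%:R : R.
have F0 x : 0 <= F x by do 2 (apply: sumr_ge0 => ? _).
apply: le_trans (sum_fractions_le k1 M (F := F) N10' F0) _.
pose E (r s : 'I_M * 'I_M) := [&& reduced N1 k1 r, reduced N2 k2 s & close d (slope R r) (slope R s)].
pose w1 := @reduced_weight R N1 k1 M; pose w2 := @reduced_weight R N2 k2 M.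
apply: (@le_trans _ _ (N1 * N2 * \sum_r \sum_(s | E r s) w1 r * w2 s)).
  rewrite mulr_sumr [leLHS]big_mkcond /=; apply: ler_sum => r _.
  case: ifPn => [rr|nr]; last by rewrite mulr_ge0 ?sumr_ge0 ?mulr_ge0 // => s _;
    rewrite mulr_ge0 ?reduced_weight_ge0.
  have /= := sum_fractions_le k2 M (F := fun y => (close d (slope R r) y)%:R) N20' _.
  move=> /(_ (fun y => ler0n _ _)) H.
  apply: le_trans (ler_wpM2l _ H) _; first by rewrite divr_ge0.
  rewrite !mulr_sumr big_mkcond [leRHS]big_mkcond /=; apply: ler_sum => s _.
  rewrite /E rr /=; case: ifPn => // rs; rewrite /w1 /w2 /reduced_weight rr rs /=.
  case: (close _ _ _) => /=; last by rewrite !mulr0.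
  by rewrite mulr1 mulrACA.
rewrite ler_wpM2l ?mulr_ge0 //.
have t0 : 'I_M * 'I_M by split; exists 0%N.
have gap1 s : exists m, \sum_(r | E r s && (r != m)) w1 r <= N1 * (2%:R * d).
  apply: (gap_sum (f := @slope R M)) => //; first by rewrite mulr_ge0.
    move=> r r' /and3P[rr _ _] /and3P[rr' _ _] ne.
    by rewrite /w1 /reduced_weight rr; exact: reduced_gap rr rr' ne.
  move=> r r' /and3P[_ _ /andP[_ h]] /and3P[_ _ /andP[_ h']].
  rewrite (_ : _ - _ = (slope R r - pow32 (slope R s)) - (slope R r' - pow32 (slope R s))); last by ring.
  by apply: le_trans (ler_normB _ _) _; lra.
have gap2 r : exists m, \sum_(s | E r s && (s != m)) w2 s <= 2%:R * N2 * (2%:R * d).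
  apply: (gap_sum (f := fun s => pow32 (slope R s))) => //; [by rewrite mulr_gt0|by rewrite mulr_ge0| |].
    move=> s s' /and3P[_ ss /andP[h _]] /and3P[_ ss' /andP[h' _]] ne.
    rewrite /w2 /reduced_weight ss (le_trans (reduced_gap ss ss' ne)) //.
    by rewrite (mulrC 2%:R) -mulrA ler_wpM2l // pow32_expand.
  move=> s s' /and3P[_ _ /andP[_ h]] /and3P[_ _ /andP[_ h']].
  rewrite (_ : _ - _ = (slope R r - pow32 (slope R s')) - (slope R r - pow32 (slope R s))); last by ring.
  by apply: le_trans (ler_normB _ _) _; lra.
have [g1 g1P] := choice gap1; have [g2 g2P] := choice gap2.
apply: le_trans (bilinear_matching (@reduced_weight_ge0 R N1 k1 M)
  (@reduced_weight_ge0 R N2 k2 M) g1P g2P) _.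
apply: lerD; first apply: lerD.
- rewrite (_ : 2 * d * N1 = N1 * (2 * d)); last by ring.
  by rewrite ler_wpM2l ?sum_reduced_weight // !mulr_ge0.
- rewrite (_ : 4 * d * N2 = 2 * N2 * (2 * d)); last by ring.
  by rewrite ler_wpM2l ?sum_reduced_weight // !mulr_ge0.
rewrite ler_pM2r // natrD mulrDl.
by apply: lerD; apply: sum_reduced_weight_sqr.
Qed.

(** A necessary condition for [v] and [v'] to lie in a common window
    [(u, u + H]] with [U <= u <= 2 U] and [H <= U]. *)
Definition near_pair (R : realType) (U H v v' : R) : bool :=
  [&& `|v - v'| <= H, U <= v <= 3%:R * U & U <= v' <= 3%:R * U].

(** A pair [i] stands for [(a, b)]. *)
Definition in_block (R : realType) (d : R) (M : nat) (i : 'I_M * 'I_M) : bool :=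
  [&& (0 < i.1)%N, d ^+ 2 <= i.2%:R & i.2%:R < 4%:R * d ^+ 2].

Definition lattice_value (R : realType) (M : nat) (i : 'I_M * 'I_M) : R :=
  i.1%:R * pow32 i.2%:R.

(** In a block [b ^ (3/2)] varies between [d ^ 3] and [8 * d ^ 3], so [a] and
    [a'] lie between [U / (8 * d ^ 3)] and [3 * U / d ^ 3]. *)
Lemma near_pair_close (R : realType) (U H d : R) (M : nat) (i i' : 'I_M * 'I_M) :
  0 < U -> 0 < d -> in_block d i -> in_block d i' ->
  near_pair U H (lattice_value R i) (lattice_value R i') ->
  [/\ i'.1%:R <= 3%:R * U / d ^+ 3, (i.1 <= 24 * i'.1)%N, (i'.2 <= 4 * i.2)%N &
      close (8%:R * H / U) (i.1%:R / i'.1%:R) (i'.2%:R / i.2%:R)].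
Proof.
case: i i' => [a b] [a' b'] U0 d0; rewrite /in_block /near_pair /lattice_value /=.
case/and3P=> a0 db bd /and3P[a0' db' bd'] /and3P[vv /andP[Uv vU] /andP[Uv' vU']].
have d2 : 0 < d ^+ 2 by rewrite exprn_gt0.
have d3 : 0 < d ^+ 3 by rewrite exprn_gt0.
have A0 : 0 < a%:R :> R by rewrite ltr0n.
have A0' : 0 < a'%:R :> R by rewrite ltr0n.
have B0 : 0 < b%:R :> R by apply: lt_le_trans db.
have B0' : 0 < b'%:R :> R by apply: lt_le_trans db'.
have lowc (n : nat) : d ^+ 2 <= n%:R -> d ^+ 3 <= pow32 n%:R :> R.
  by move=> h; rewrite -pow32_sqr ?(ltW d0) // pow32_le // ltW.
have highc (n : nat) : n%:R < 4%:R * d ^+ 2 -> pow32 n%:R <= 8%:R * d ^+ 3 :> R.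
  move=> h; rewrite (_ : 8%:R * d ^+ 3 = (2%:R * d) ^+ 3); last by rewrite exprMn -natrX.
  rewrite -pow32_sqr ?mulr_ge0 ?(ltW d0) // pow32_le // exprMn -natrX; exact: ltW.
have c1 := lowc _ db; have c1' := lowc _ db'; have c2 := highc _ bd; have c2' := highc _ bd'.
have up (n m : nat) : d ^+ 3 <= pow32 m%:R -> n%:R * pow32 m%:R <= 3%:R * U -> n%:R * d ^+ 3 <= 3%:R * U.
  by move=> h1 h2; apply: le_trans h2; rewrite ler_wpM2l.
have ua := up _ _ c1 vU; have ua' := up _ _ c1' vU'.
have la' : U <= a'%:R * (8%:R * d ^+ 3) by apply: le_trans Uv' _; rewrite ler_wpM2l.
split.
- by rewrite ler_pdivlMr.
- rewrite -(ler_nat R) natrM -(ler_pM2r d3); lra.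
- rewrite -(ler_nat R) natrM; lra.
rewrite /close; apply/andP; split.
  rewrite mulrA ler_pdivlMr // mul1r; lra.
have C0 : 0 < pow32 b%:R :> R by apply: (lt_le_trans d3).
have C0' : 0 < pow32 b'%:R :> R by apply: (lt_le_trans d3).
have -> : pow32 (b'%:R / b%:R) = pow32 b'%:R / pow32 b%:R :> R.
  apply: (mulIf (lt0r_neq0 C0)); rewrite divfK ?lt0r_neq0 // -pow32M ?divfK ?lt0r_neq0 //.
have -> : a%:R / a'%:R - pow32 b'%:R / pow32 b%:R =
   (a%:R * pow32 b%:R - a'%:R * pow32 b'%:R) / (a'%:R * pow32 b%:R) :> R.
  by field; rewrite !gt_eqF.
have P0 : 0 < a'%:R * pow32 b%:R :> R by rewrite mulr_gt0.
have H0 : 0 <= H by apply: le_trans vv.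
rewrite normrM normfV (gtr0_norm P0) ler_pdivrMr // (le_trans vv) //.
rewrite mulrAC ler_pdivlMr // (mulrC 8%:R) -mulrA ler_wpM2l //.
have : a'%:R * d ^+ 3 <= a'%:R * pow32 b%:R by rewrite ler_wpM2l // ltW.
lra.
Qed.

(** This is [close_fractions_count] with [N1 = 3 * U / d ^ 3], [N2 = 4 * d ^ 2]
    and precision [8 * H / U]; then [N1 * N2 = 12 * U / d], the factor
    [104 = 2 * 4 + 4 * 24] collects the two terms of expected size, and
    [96 = 8 * 12]. *)
Lemma near_pair_count (R : realType) (U H d : R) (M : nat) :
  0 < U -> 0 <= H -> 0 < d -> (0 < M)%N ->
  \sum_(i : 'I_M * 'I_M | in_block d i) \sum_(i' : 'I_M * 'I_M | in_block d i')
     (near_pair U H (lattice_value R i) (lattice_value R i'))%:R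
  <= 12%:R * (U / d) * ((104%:R * 96%:R) * (H / d) + 14%:R * (1 + ln M%:R)).
Proof.
move=> U0 H0 d0 M0.
have N10 : 0 < 3%:R * U / d ^+ 3 by rewrite divr_gt0 ?mulr_gt0 ?exprn_gt0.
have N20 : 0 < 4%:R * d ^+ 2 by rewrite mulr_gt0 ?exprn_gt0.
have dl0 : 0 <= 8%:R * H / U by rewrite divr_ge0 ?mulr_ge0 // ltW.
have := close_fractions_count 24 4 N10 N20 dl0 M0.
set S := (X in X <= _) => HS.
apply: (@le_trans _ _ S); last first.
  apply: le_trans HS _; rewrite le_eqVlt; apply/orP; left; apply/eqP.
  by field; rewrite !gt_eqF.
rewrite /S; under [leRHS]eq_bigr => a _ do rewrite big_mkcond /=.
rewrite [leRHS]big_mkcond /=.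
rewrite big_mkcond /= -(pair_bigA _ (fun a b => if in_block d (a, b)
   then \sum_(i' : 'I_M * 'I_M | in_block d i')
     (near_pair U H (lattice_value R (a, b)) (lattice_value R i'))%:R else 0)) /=.
apply: ler_sum => a _; case: (posnP a) => [a0|a0].
  by rewrite big1 // => b _; rewrite /in_block /= a0.
apply: (@le_trans _ _ (\sum_(b < M) \sum_(a' < M) \sum_(b' < M)
   if in_block d (a, b) && in_block d (a', b') then
     (near_pair U H (lattice_value R (a, b)) (lattice_value R (a', b')))%:R else 0)).
  apply: ler_sum => b _; case: ifP => _; last by rewrite !sumr_ge0 // => a' _; rewrite sumr_ge0.
  by rewrite big_mkcond /= -(pair_bigA _ (fun a' b' => if in_block d (a', b') then
     (near_pair U H (lattice_value R (a, b)) (lattice_value R (a', b')))%:R else 0)).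
rewrite exchange_big /=; apply: ler_sum => a' _.
rewrite exchange_big /= (_ : (if _ then _ else _) = \sum_(b' < M) \sum_(b < M)
  if [&& (0 < a')%N, a'%:R <= 3%:R * U / d ^+ 3, (a <= 24 * a')%N, (0 < b')%N, (0 < b)%N,
    b%:R <= 4%:R * d ^+ 2 & (b' <= 4 * b)%N]
  then (close (8%:R * H / U) (a%:R / a'%:R) (b'%:R / b%:R))%:R else 0); last first.
  case: ifP => [/and3P[-> -> ->]|no] /=.
    rewrite big_mkcond; apply: eq_bigr => b' _; case: (posnP b') => [b0|b0] /=; first by rewrite big1.
    by rewrite big_mkcond.
  symmetry; apply: big1 => b' _; apply: big1 => b _; case: ifP => // /and4P[h1 h2 h3 _].
  by rewrite h1 h2 h3 in no.
apply: ler_sum => b' _; apply: ler_sum => b _.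
case: ifP => [/andP[hi hi']|_]; last by case: ifP.
case np : (near_pair _ _ _ _); last by case: ifP.
have [/= h1 h2 h3 h4] := near_pair_close U0 d0 hi hi' np.
rewrite h1 h2 h3 h4 /=; case/and3P: hi' => /= -> db' _; case/and3P: hi => /= _ db bd.
have d2 : 0 < d ^+ 2 by rewrite exprn_gt0.
have -> : (0 < b')%N by rewrite -(ltr0n R); apply: lt_le_trans db'.
have -> : (0 < b)%N by rewrite -(ltr0n R); apply: lt_le_trans db.
by rewrite (ltW bd).
Qed.

(** * The pointwise decomposition *)

Lemma sqr_cube_le_sqr (R : realType) (a b : nat) (v : R) : 0 <= v ->
  (a ^ 2 * b ^ 3 <= Num.truncn (v ^+ 2))%N = (a%:R * pow32 b%:R <= v).
Proof.
move=> v0; rewrite truncn_ge_nat ?sqr_ge0 // natrM !natrX.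
by rewrite -(sqr_pow32 (ler0n R b)) -exprMn ler_sqr ?nnegrE ?mulr_ge0 ?pow32_ge0.
Qed.

Lemma squarefull_count_sqr (R : realType) (M : nat) (v : R) :
  0 <= v -> (Num.truncn (v ^+ 2) < M)%N ->
  (squarefull_count (v ^+ 2))%:R =
  \sum_(b < M | squarefree b) \sum_(a < M | (0 < a)%N) (a%:R * pow32 b%:R <= v)%R%:R :> R.
Proof.
move=> v0 vM; rewrite (squarefull_count_sum vM) natr_sum; apply: eq_bigr => b _.
rewrite natr_sum big_mkcondr /=; apply: eq_bigr => a _.
by rewrite sqr_cube_le_sqr //; case: ifP.
Qed.

Definition window (R : realType) (M : nat) (u H c : R) : R :=
  \sum_(a < M | (0 < a)%N) (u < a%:R * c <= u + H)%R%:R.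

Lemma squarefull_count_window (R : realType) (M : nat) (u H : R) :
  0 <= u -> 0 <= H -> (Num.truncn ((u + H) ^+ 2) < M)%N ->
  (squarefull_count ((u + H) ^+ 2))%:R - (squarefull_count (u ^+ 2))%:R =
  \sum_(b < M | squarefree b) window M u H (pow32 b%:R).
Proof.
move=> u0 H0 TM; have uH : u <= u + H by rewrite lerDl.
have TM' : (Num.truncn (u ^+ 2) < M)%N.
  by apply: leq_ltn_trans TM; apply: le_truncn; rewrite ler_sqr ?nnegrE ?(le_trans u0).
rewrite (squarefull_count_sqr _ TM) ?(le_trans u0) // (squarefull_count_sqr u0 TM').
rewrite -sumrB; apply: eq_bigr => b _; rewrite -sumrB; apply: eq_bigr => a _.
rewrite ltNge; have [h|h] := leP _ u; first by rewrite (le_trans h uH) subrr.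
by rewrite subr0.
Qed.

Lemma count_le_floor (R : realType) (M : nat) (c v : R) : 0 < c -> 0 <= v ->
  (Num.truncn (v / c) < M)%N ->
  \sum_(a < M | (0 < a)%N) (a%:R * c <= v)%R%:R = (Num.truncn (v / c))%:R :> R.
Proof.
move=> c0 v0 TM; set T := Num.truncn _ in TM *.
rewrite -(bigop_ord_gt0 _ M (fun a => (a%:R * c <= v)%R%:R)).
rewrite (big_cat_nat _ (n := T.+1)) //= [X in _ + X]big_nat [X in _ + X]big1 ?addr0; last first.
  move=> a /andP[Ta _]; rewrite -ler_pdivlMr // -truncn_ge_nat ?divr_ge0 ?(ltW c0) //.
  by rewrite leqNgt Ta.
rewrite big_nat (eq_bigr (fun=> 1)); last first.
  move=> a /andP[_ aT]; rewrite -ler_pdivlMr // -truncn_ge_nat ?divr_ge0 ?(ltW c0) //.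
  by rewrite -ltnS aT.
by rewrite -big_nat big_const_nat subn1 /= iter_addr addr0.
Qed.

Lemma window_near (R : realType) (M : nat) (u H c : R) : 0 < c -> 0 <= u -> 0 <= H ->
  (Num.truncn ((u + H) / c) < M)%N -> `|window M u H c - H / c| <= 1.
Proof.
move=> c0 u0 H0 TM; have uH : u <= u + H by rewrite lerDl.
have TM' : (Num.truncn (u / c) < M)%N.
  by apply: leq_ltn_trans TM; apply: le_truncn; rewrite ler_pM2r ?invr_gt0.
have -> : window M u H c = (Num.truncn ((u + H) / c))%:R - (Num.truncn (u / c))%:R.
  rewrite -(count_le_floor c0 u0 TM') -(count_le_floor c0 _ TM) ?(le_trans u0) //.
  rewrite -sumrB; apply: eq_bigr => a _.
  rewrite ltNge; have [h|h] := leP _ u; first by rewrite (le_trans h uH) subrr.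
  by rewrite subr0.
have /andP[l1 l2] : ((Num.truncn (u / c))%:R <= u / c < (Num.truncn (u / c)).+1%:R).
  by apply: truncn_itv; rewrite divr_ge0 // ltW.
have /andP[h1 h2] : ((Num.truncn ((u + H) / c))%:R <= (u + H) / c < (Num.truncn ((u + H) / c)).+1%:R).
  by apply: truncn_itv; rewrite divr_ge0 ?(ltW c0) // (le_trans u0).
move: h1 h2 l1 l2; rewrite -!natr1 mulrDl => h1 h2 l1 l2.
rewrite ler_norml; apply/andP; split; lra.
Qed.

Lemma window_ge0 (R : realType) (M : nat) (u H c : R) : 0 <= window M u H c.
Proof. by apply: sumr_ge0. Qed.

(** The terms with [b <= h ^ 2] have error at most 1 each, and the terms of the
    constant with [b > h ^ 2] add up to at most [3 / h], which is why the cut is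
    made at the two-thirds power of [H = h ^ 3]. *)
Lemma squarefull_count_pointwise (R : realType) (M : nat) (u h : R) :
  1 <= h -> 0 <= u -> (Num.truncn ((u + h ^+ 3) ^+ 2) < M)%N -> 1 <= u + h ^+ 3 ->
  `|(squarefull_count ((u + h ^+ 3) ^+ 2))%:R - (squarefull_count (u ^+ 2))%:R
     - zeta (3%:R / 2%:R) / zeta 3%:R * h ^+ 3|
  <= 4%:R * h ^+ 2 + \sum_(b < M | h ^+ 2 < b%:R) window M u (h ^+ 3) (pow32 b%:R).
Proof.
move=> h1 u0 TM v1; set H := h ^+ 3.
have h0 : 0 < h by lra.
have H0 : 0 <= H by rewrite exprn_ge0 // ltW.
rewrite (squarefull_count_window u0 H0 TM).
set k := zeta _ / _.
pose B := Num.truncn (h ^+ 2).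
have h21 : 1 <= h ^+ 2 by rewrite exprn_ege1.
have B0 : (0 < B)%N by rewrite truncn_gt0.
have BE (n : nat) : (n < B.+1)%N = (n%:R <= h ^+ 2) by rewrite ltnS truncn_ge_nat // exprn_ge0 // ltW.
have BM : (B.+1 <= M)%N.
  apply: leq_ltn_trans TM; apply: le_truncn; apply: (@le_trans _ _ H).
    by rewrite /H ler_weXn2l.
  by rewrite (@le_trans _ _ (u + H)) ?lerDr // expr2 ler_peMr // (le_trans ler01).
set S := \sum_(b < B.+1 | squarefree b) (pow32 b%:R)^-1 : R.
have -> : \sum_(b < M | squarefree b) window M u H (pow32 b%:R) - k * H =
   \sum_(b < B.+1 | squarefree b) (window M u H (pow32 b%:R) - H / pow32 b%:R)
   + \sum_(b < M | squarefree b && (h ^+ 2 < b%:R)) window M u H (pow32 b%:R)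
   + H * (S - k).
  rewrite sumrB -mulr_sumr (bigID (fun b : 'I_M => (b < B.+1)%N)) /=.
  rewrite -(big_ord_widen_cond M (fun b => squarefree b) (fun b => window M u H (pow32 b%:R)) BM) /=.
  have -> : \sum_(b < M | squarefree b && ~~ (b < B.+1)%N) window M u H (pow32 b%:R) =
            \sum_(b < M | squarefree b && (h ^+ 2 < b%:R)) window M u H (pow32 b%:R).
    by apply: eq_bigl => b; rewrite BE -ltNge.
  rewrite -/S; ring.
apply: le_trans (ler_normD _ _) _.
apply: le_trans (lerD (ler_normD _ _) (lexx _)) _.
have e1 : `|\sum_(b < B.+1 | squarefree b) (window M u H (pow32 b%:R) - H / pow32 b%:R)| <= h ^+ 2.
  apply: le_trans (ler_norm_sum _ _ _) _.
  apply: (@le_trans _ _ (\sum_(b < B.+1 | [&& (0 < b)%N, b%:R <= h ^+ 2 & (1 %| b)%N]) 1)); last first.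
    by apply: le_trans (count_multiples_le _ (ltn0Sn 0) (le_trans ler01 h21)) _; rewrite divr1.
  rewrite [leRHS](eq_bigl (fun b : 'I_B.+1 => (0 < b)%N)); last first.
    by move=> b; rewrite -BE ltn_ord dvd1n !andbT.
  apply: (@le_trans _ _ (\sum_(b < B.+1 | squarefree b) 1)); last first.
    by apply: ler_sum_subpred => // b; apply: squarefree_gt0.
  apply: ler_sum => b sb; have b0 := squarefree_gt0 sb.
  apply: window_near => //; first by rewrite pow32_gt0 // ltr0n.
  apply: leq_ltn_trans TM; apply: le_truncn.
  have p1 : 1 <= pow32 b%:R :> R.
    by rewrite /pow32 mulr_ege1 ?ler1n // -[leLHS]sqrtr1 ler_sqrt // ler1n.
  apply: (@le_trans _ _ (u + H)); last by rewrite expr2 ler_peMr // (le_trans ler01).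
  by rewrite ler_pdivrMr ?(lt_le_trans ltr01) // ler_peMr // (le_trans ler01).
have e2 : `|\sum_(b < M | squarefree b && (h ^+ 2 < b%:R)) window M u H (pow32 b%:R)|
   <= \sum_(b < M | h ^+ 2 < b%:R) window M u H (pow32 b%:R).
  rewrite ger0_norm; last by apply: sumr_ge0 => b _; apply: window_ge0.
  by apply: ler_sum_subpred => [b /andP[]|b] //; apply: window_ge0.
have e3 : `|H * (S - k)| <= 3%:R * h ^+ 2.
  rewrite normrM (ger0_norm H0) distrC.
  apply: (@le_trans _ _ (H * (2%:R / Num.sqrt B%:R))); first by rewrite ler_wpM2l // zeta_ratio.
  have sB : 0 < Num.sqrt B%:R :> R by rewrite sqrtr_gt0 ltr0n.
  rewrite mulrA ler_pdivrMr //.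
  rewrite (_ : H * 2 = h ^+ 2 * (h * 2)); last by rewrite /H; ring.
  rewrite (_ : 3 * h ^+ 2 * Num.sqrt B%:R = h ^+ 2 * (3 * Num.sqrt B%:R)); last by ring.
  rewrite ler_wpM2l ?exprn_ge0 ?(ltW h0) //.
  rewrite -ler_sqr ?nnegrE ?mulr_ge0 ?(ltW h0) ?(ltW sB) //.
  rewrite !exprMn sqr_sqrtr ?ler0n // -!natrX.
  have /andP[_ hB] : (B%:R <= h ^+ 2 < B.+1%:R).
    by apply: truncn_itv; rewrite exprn_ge0 // ltW.
  move: hB; rewrite -natr1 => hB; have B1 : 1 <= B%:R :> R by rewrite ler1n.
  lra.
lra.
Qed.

Lemma block_cover (R : realType) (M : nat) (h : R) (g : nat -> R) :
  1 <= h -> (forall b, 0 <= g b) ->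
  \sum_(b < M | h ^+ 2 < b%:R) g b <=
  \sum_(j < M) \sum_(b < M | ((2%:R ^+ j * h) ^+ 2 <= b%:R < 4%:R * (2%:R ^+ j * h) ^+ 2)) g b.
Proof.
move=> h1 g0; have h0 : 0 < h by lra.
have h21 : 1 <= h ^+ 2 by rewrite exprn_ege1.
under [leRHS]eq_bigr => j _ do rewrite big_mkcond /=.
rewrite exchange_big /= big_mkcond /=; apply: ler_sum => b _.
case: ifP => [hb|_]; last by apply: sumr_ge0 => j _; case: ifP.
have sqE (j : nat) : (2%:R ^+ j * h) ^+ 2 = 4%:R ^+ j * h ^+ 2 :> R.
  by rewrite exprMn -exprM mulnC exprM (_ : 2%:R ^+ 2 = 4%:R) // -natrX.
have ex : exists j, b%:R < 4%:R ^+ j.+1 * h ^+ 2.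
  exists b; apply: (@lt_le_trans _ _ (4%:R ^+ b.+1)); last by rewrite ler_peMr // exprn_ge0.
  by rewrite -natrX ltr_nat (@ltn_trans b.+1) // ltn_expl.
case: (ex_minnP ex) => j jb jmin.
have jM : (j < M)%N.
  apply: leq_ltn_trans (ltn_ord b); apply: jmin.
  apply: (@lt_le_trans _ _ (4%:R ^+ b.+1)); last by rewrite ler_peMr // exprn_ge0.
  by rewrite -natrX ltr_nat (@ltn_trans b.+1) // ltn_expl.
rewrite (bigD1 (Ordinal jM)) //= !sqE mulrA -exprS jb andbT.
have -> : 4%:R ^+ j * h ^+ 2 <= b%:R.
  case: j jmin {jb jM} => [_|j jmin]; first by rewrite mul1r ltW.
  by rewrite leNgt; apply/negP => /jmin; rewrite ltnn.
by rewrite lerDl; apply: sumr_ge0 => i _; case: ifP.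
Qed.

(** Iterate [(x + y) ^ 2 <= 3 * x ^ 2 + 3/2 * y ^ 2].  The factor 3/2 is less
    than the ratio 2 at which the bounds for the blocks decay. *)
Lemma sqr_sum_geometric (R : realType) (J : nat) (x : nat -> R) :
  (\sum_(j < J) x j) ^+ 2 <= 3%:R * \sum_(j < J) (3%:R / 2%:R) ^+ j * x j ^+ 2.
Proof.
elim: J x => [|J IH] x; first by rewrite !big_ord0 expr0n mulr0.
rewrite !big_ord_recl /= expr0 mul1r; have := IH (fun j => x j.+1).
set y := \sum_(i < J) x _; set Y := \sum_(i < J) _ => h.
have -> : \sum_(i < J) (3%:R / 2%:R) ^+ bump 0 i * x (bump 0 i) ^+ 2 = (3%:R / 2%:R) * Y :> R.
  by rewrite /Y mulr_sumr; apply: eq_bigr => i _; rewrite mulrA -exprS.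
rewrite -/y.
have := sqr_ge0 (2%:R * x 0%N - y); nra.
Qed.

(** * The variance *)

(** The integral of a nonnegative function is the supremum of the integrals of
    the simple functions below it, which is monotone for arbitrary functions. *)
Lemma ge0_integral_mono (d : measure_display) (T : measurableType d) (R : realType)
    (mu : {measure set T -> \bar R}) (D : set T) (f g : T -> \bar R) :
  (forall x, D x -> 0 <= f x)%E -> (forall x, D x -> f x <= g x)%E ->
  (\int[mu]_(x in D) f x <= \int[mu]_(x in D) g x)%E.
Proof.
move=> f0 fg; have g0 x : D x -> (0 <= g x)%E by move=> Dx; apply: le_trans (fg x Dx); apply: f0.
rewrite !ge0_integralE //; apply: le_ereal_sup => _ [h hf <-].
exists h => // x; apply: le_trans (hf x) _; rewrite !patchE.
by case: ifP => // /set_mem /fg.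
Qed.

Lemma Rintegral_le_steps (R : realType) (a b c0 : R) (f : R -> R) (T : finType) (c l r : T -> R) :
  a <= b -> 0 <= c0 -> (forall t, 0 <= c t) -> (forall t, l t <= r t) ->
  (forall x, a <= x <= b -> 0 <= f x <= c0 + \sum_t c t * (l t <= x <= r t)%R%:R) ->
  \int[lebesgue_measure]_(x in `[a, b]) f x <= c0 * (b - a) + \sum_t c t * (r t - l t).
Proof.
move=> ab c00 c_ge0 lr fG; pose D : set (measurableTypeR R) := `[a, b]%classic.
pose mu : {measure set (measurableTypeR R) -> \bar R} := @lebesgue_measure R.
have mD : measurable D by apply: measurable_itv.
have muI (p q : R) : p <= q -> mu `[p, q]%classic = (q - p)%:E.
  move=> pq; rewrite /mu /= lebesgue_measure_itv /= lte_fin; case: ltP => // qp.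
  by rewrite (@le_anti _ _ p q) ?pq ?qp // subrr.
pose I t : set (measurableTypeR R) := `[l t, r t]%classic.
have mI t : measurable (I t) by apply: measurable_itv.
have f0 x : D x -> (0 <= (f x)%:E)%E.
  by rewrite /D /= in_itv /= => /fG /andP[]; rewrite lee_fin.
have mterm t : measurable_fun D (fun x => (\1_(I t) x : R)%:E).
  by apply/measurable_EFinP; apply: measurable_indic.
have main : (\int[mu]_(x in D) (f x)%:E <= (c0 * (b - a) + \sum_t c t * (r t - l t))%:E)%E.
  apply: (@le_trans _ _ (\int[mu]_(x in D) (c0%:E + \sum_t (c t)%:E * (\1_(I t) x)%:E)))%E.
    apply: ge0_integral_mono => // x Dx.
    have := Dx; rewrite /D /= in_itv /= => /fG /andP[_ h].
    under eq_bigr => t _ do rewrite -EFinM.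
    rewrite sumEFin -EFinD lee_fin; apply: le_trans h _; rewrite lerD2l; apply: ler_sum => t _.
    by rewrite ler_wpM2l // indicE /I mem_setE in_itv.
  rewrite ge0_integralD //=; last 2 first.
  - by move=> x _; apply: sume_ge0 => t _; rewrite mule_ge0 // lee_fin.
  - by apply: emeasurable_sum => t; apply: measurable_funeM.
  rewrite ge0_integral_sum //; last 2 first.
  - by move=> t; apply: measurable_funeM.
  - by move=> t x _; rewrite mule_ge0 // lee_fin.
  rewrite integral_cst //= EFinD -sumEFin muI // EFinM; apply: leeD => //.
  apply: lee_sum => t _; rewrite ge0_integralZl_EFin //.
  rewrite EFinM lee_wpmul2l ?lee_fin // integral_indic //.
  by rewrite -(muI (l t) (r t)) //; apply: le_measure; rewrite ?inE //; apply: measurableI.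
rewrite /Rintegral -lee_fin fineK //.
rewrite ge0_fin_numE; last by apply: integral_ge0 => x; apply: f0.
by apply: le_lt_trans main _; rewrite ltry.
Qed.

Lemma block_window_sum (R : realType) (M : nat) (u H d : R) :
  \sum_(b < M | d ^+ 2 <= b%:R < 4%:R * d ^+ 2) window M u H (pow32 b%:R) =
  \sum_(i : 'I_M * 'I_M | in_block d i) (u < lattice_value R i <= u + H)%R%:R.
Proof.
rewrite /window pair_big_dep /= (reindex (fun i : 'I_M * 'I_M => (i.2, i.1))) /=; last first.
  by exists (fun i => (i.2, i.1)) => -[].
by apply: eq_bigl => i; rewrite /in_block andbC andbA.
Qed.

(** Expand the square; if [v] lies in [(u, u + H]], then [u ^ 2] lies in an
    interval with right end [v ^ 2] and length [2 * v * H]. *)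
Lemma block_window_sqr_le (R : realType) (M : nat) (u U H d : R) :
  0 <= H <= U -> U <= u <= 2%:R * U ->
  (\sum_(b < M | d ^+ 2 <= b%:R < 4%:R * d ^+ 2) window M u H (pow32 b%:R)) ^+ 2 <=
  \sum_(i : 'I_M * 'I_M | in_block d i) \sum_(i' : 'I_M * 'I_M | in_block d i')
    (near_pair U H (lattice_value R i) (lattice_value R i'))%:R *
    (lattice_value R i ^+ 2 - 2%:R * lattice_value R i * H <= u ^+ 2 <= lattice_value R i ^+ 2)%R%:R.
Proof.
move=> /andP[H0 HU] /andP[Uu uU]; rewrite block_window_sum expr2 big_distrlr /=.
apply: ler_sum => i _; apply: ler_sum => i' _.
move: (lattice_value R i) (lattice_value R i') => v v'.
have [/andP[h1 h2]|_] := boolP (u < v <= u + H); last by rewrite mul0r mulr_ge0.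
have [/andP[h1' h2']|_] := boolP (u < v' <= u + H); last by rewrite mulr0 mulr_ge0.
have -> : near_pair U H v v'.
  by rewrite /near_pair ler_norml; apply/and3P; split; apply/andP; split; lra.
have -> : v ^+ 2 - 2 * v * H <= u ^+ 2 <= v ^+ 2 by apply/andP; split; nra.
by rewrite mulr1.
Qed.

Lemma geometric_le4 (R : realType) (J : nat) : \sum_(j < J) (3%:R / 4%:R) ^+ j <= 4%:R :> R.
Proof.
suff : \sum_(j < J) (3%:R / 4%:R) ^+ j = 4%:R - 4%:R * (3%:R / 4%:R) ^+ J :> R.
  by move=> ->; rewrite gerBl mulr_ge0 // exprn_ge0 // divr_ge0.
elim: J => [|J IH]; first by rewrite big_ord0 expr0; ring.
by rewrite big_ord_recr /= IH exprSr; field.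
Qed.

(** The block of [d = 2 ^ j * h] contributes [O(h ^ 4 / 2 ^ j)] to the mean
    square, and the weight [(3/2) ^ j] leaves the convergent series of
    [(3/4) ^ j].  The constant is [1728 = 4 * 432], with [432 = 6 * 12 * 6]. *)
Lemma variance_le (R : realType) (X h C : R) :
  1 <= X -> 1 <= h -> h ^+ 3 <= Num.sqrt X -> 0 <= C ->
  1 + ln (Num.truncn (9%:R * X)).+1%:R <= C * h ^+ 2 ->
  1 / X * (\int[lebesgue_measure]_(x in `[X, 2%:R * X])
              (let y := 2%:R * Num.sqrt x * (h ^+ 3) + (h ^+ 3) ^+ 2 in
               `|(squarefull_count (x + y))%:R - (squarefull_count x)%:R
                 - zeta (3%:R / 2%:R) / zeta 3%:R * (h ^+ 3)| ^+ 2))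
  <= (32%:R + 1728%:R * ((104%:R * 96%:R) + 14%:R * C)) * h ^+ 4.
Proof.
move=> X1 h1; set H := h ^+ 3; set U := Num.sqrt X; move=> HU C0.
set M := (Num.truncn _).+1; set L := 1 + ln _ => LC.
have X0 : 0 < X by lra.
have h0 : 0 < h by lra.
have U0 : 0 < U by rewrite sqrtr_gt0.
have H0 : 0 < H by rewrite exprn_gt0.
have UX : U ^+ 2 = X by rewrite sqr_sqrtr // ltW.
pose d (j : nat) : R := 2%:R ^+ j * h.
pose T2 := ('I_M * 'I_M)%type.
pose v (i : T2) : R := lattice_value R i.
have v0 i : 0 <= v i by rewrite mulr_ge0 ?pow32_ge0.
pose w (t : 'I_M * (T2 * T2)) : R :=
  [&& in_block (d t.1) t.2.1, in_block (d t.1) t.2.2 & near_pair U H (v t.2.1) (v t.2.2)]%:R.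
pose c t : R := 6%:R * (3%:R / 2%:R) ^+ (t : 'I_M * (T2 * T2)).1 * w t.
have g0 (j : nat) : 0 <= (3%:R / 2%:R) ^+ j :> R by rewrite exprn_ge0.
have c0 t : 0 <= c t by rewrite !mulr_ge0 // ler0n.
have sumT (F : nat -> T2 -> T2 -> R) (G : nat -> R) :
   \sum_(t : 'I_M * (T2 * T2)) G t.1 * w t * F t.1 t.2.1 t.2.2 =
   \sum_(j < M) G j * \sum_(i : T2 | in_block (d j) i) \sum_(i' : T2 | in_block (d j) i')
      (near_pair U H (v i) (v i'))%:R * F j i i'.
  rewrite -(pair_bigA _ (fun (j : 'I_M) (p : T2 * T2) => G j * w (j, p) * F j p.1 p.2)) /=;
    apply: eq_bigr => j _.
  rewrite -(pair_bigA _ (fun i i' : T2 => G j * w (j, (i, i')) * F j i i')) /= mulr_sumr.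
  rewrite [RHS]big_mkcond /=; apply: eq_bigr => i _; rewrite /w /=.
  case: (in_block (d j) i) => /=; last by rewrite big1 // => i' _; rewrite mulr0 mul0r.
  rewrite [in RHS]big_mkcond mulr_sumr /=; apply: eq_bigr => i' _.
  by case: (in_block (d j) i') => /=; rewrite ?mulrA // !(mulr0, mul0r).
set f := (fun x => _ : R).
have step : \int[lebesgue_measure]_(x in `[X, 2%:R * X]) f x <=
   32%:R * h ^+ 4 * (2%:R * X - X) + \sum_t c t * (v t.2.1 ^+ 2 - (v t.2.1 ^+ 2 - 2%:R * v t.2.1 * H)).
  apply: Rintegral_le_steps => //; first by lra.
  - by rewrite mulr_ge0 // exprn_ge0 // ltW.
  - by move=> t; rewrite gerBl !mulr_ge0 // ltW.
  move=> x /andP[Xx xX]; rewrite /f /= sqr_ge0 /=.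
  have x0 : 0 <= x by lra.
  set u := Num.sqrt x; have ux : u ^+ 2 = x by rewrite sqr_sqrtr.
  have u0 : 0 <= u by rewrite sqrtr_ge0.
  have Uu : U <= u by rewrite ler_sqrt.
  have uU : u <= 2%:R * U.
    by rewrite -ler_sqr ?nnegrE ?mulr_ge0 ?(ltW U0) // exprMn UX ux; lra.
  have -> : x + (2%:R * u * H + H ^+ 2) = (u + H) ^+ 2 by rewrite -ux; ring.
  have TM : (Num.truncn ((u + H) ^+ 2) < M)%N.
    rewrite ltnS; apply: le_truncn; rewrite -UX.
    by have : u + H <= 3%:R * U; [lra|nra].
  have v1 : 1 <= u + h ^+ 3.
    have : 1 <= h ^+ 3 by rewrite exprn_ege1.
    lra.
  have := squarefull_count_pointwise h1 u0 TM v1; rewrite -/H ux.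
  set Z := `|_|; set N := \sum_(b < M | _) _ => ZN.
  have Z0 : 0 <= Z by exact: normr_ge0.
  have N0 : 0 <= N by apply: sumr_ge0 => b _; apply: window_ge0.
  have Zsq : Z ^+ 2 <= 32%:R * h ^+ 4 + 2%:R * N ^+ 2.
    have h4 : h ^+ 4 = (h ^+ 2) ^+ 2 by rewrite -exprM.
    have := sqr_ge0 (4%:R * h ^+ 2 - N); rewrite h4.
    have : Z ^+ 2 <= (4%:R * h ^+ 2 + N) ^+ 2 by rewrite ler_sqr ?nnegrE // addr_ge0 // mulr_ge0 // sqr_ge0.
    nra.
  apply: le_trans Zsq _; rewrite lerD2l.
  pose n (j : nat) := \sum_(b < M | d j ^+ 2 <= b%:R < 4%:R * d j ^+ 2) window M u H (pow32 b%:R).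
  have NN : N <= \sum_(j < M) n j.
    by apply: (block_cover M h1 (g := fun b => window M u H (pow32 b%:R))) => b; apply: window_ge0.
  have NN2 : N ^+ 2 <= 3%:R * \sum_(j < M) (3%:R / 2%:R) ^+ j * n j ^+ 2.
    apply: le_trans (sqr_sum_geometric _ n); rewrite ler_sqr ?nnegrE //.
    by apply: le_trans NN.
  apply: le_trans (ler_wpM2l (ler0n _ 2) NN2) _.
  rewrite mulrA -natrM mulr_sumr.
  rewrite (sumT (fun j i i' => (v i ^+ 2 - 2%:R * v i * H <= x <= v i ^+ 2)%R%:R)
             (fun j => 6%:R * (3%:R / 2%:R) ^+ j)).
  apply: ler_sum => j _; rewrite mulrA ler_wpM2l ?mulr_ge0 //.
  rewrite -ux; apply: block_window_sqr_le; first by rewrite HU ltW.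
  by rewrite Uu uU.
rewrite div1r mulrC ler_pdivrMr //; apply: le_trans step _.
have -> : (32%:R + 1728%:R * ((104%:R * 96%:R) + 14%:R * C)) * h ^+ 4 * X =
   32%:R * h ^+ 4 * (2%:R * X - X) + X * (1728%:R * ((104%:R * 96%:R) + 14%:R * C)) * h ^+ 4 by ring.
rewrite lerD2l.
apply: (@le_trans _ _ (\sum_t c t * (6%:R * U * H))).
  apply: ler_sum => t _; rewrite /c /w.
  case: and3P => [[_ _ /and3P[_ /andP[_ vU] _]]|_]; last by rewrite mulr0 !mul0r.
  rewrite ler_wpM2l ?mulr1 ?mulr_ge0 // opprB addrC subrK ler_wpM2r ?(ltW H0) //; lra.
rewrite /c (sumT (fun j i i' => 6%:R * U * H) (fun j => 6%:R * (3%:R / 2%:R) ^+ j)).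
apply: (@le_trans _ _ (\sum_(j < M) (3%:R / 4%:R) ^+ j * (X * 432%:R * ((104%:R * 96%:R) + 14%:R * C) * h ^+ 4))).
  apply: ler_sum => j _; under eq_bigr => i _ do rewrite -mulr_suml.
  rewrite -mulr_suml.
  have p2 : 1 <= 2%:R ^+ j :> R by rewrite exprn_ege1 // ler1n.
  have p20 : 0 < 2%:R ^+ j :> R by lra.
  have d0 : 0 < d j by rewrite mulr_gt0.
  have j0 : 0 <= 6%:R * (3%:R / 2%:R) ^+ j :> R by rewrite mulr_ge0.
  have UH0 : 0 <= 6%:R * U * H by rewrite !mulr_ge0 // ltW.
  have Hd : H / d j = h ^+ 2 / 2%:R ^+ j by rewrite /H /d; field; rewrite !gt_eqF.
  have Hd2 : H / d j <= h ^+ 2 by rewrite Hd ler_pdivrMr // ler_peMr // sqr_ge0.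
  apply: (@le_trans _ _ (6%:R * (3%:R / 2%:R) ^+ j *
     (12%:R * (U / d j) * ((104%:R * 96%:R) * (H / d j) + 14%:R * L) * (6%:R * U * H)))).
    apply: ler_wpM2l; [exact: j0 | apply: ler_wpM2r; [exact: UH0 |]].
    by apply: near_pair_count => //; apply: ltW.
  apply: (@le_trans _ _ (6%:R * (3%:R / 2%:R) ^+ j *
     (12%:R * (U / d j) * ((104%:R * 96%:R) * h ^+ 2 + 14%:R * (C * h ^+ 2)) * (6%:R * U * H)))).
    apply: ler_wpM2l; [exact: j0 | apply: ler_wpM2r; [exact: UH0 | apply: ler_wpM2l]].
      by rewrite mulr_ge0 // divr_ge0 ?(ltW U0) ?(ltW d0).
    by apply: lerD; rewrite ler_wpM2l.
  rewrite le_eqVlt; apply/orP; left; apply/eqP.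
  have -> : (3%:R / 4%:R) ^+ j = (3%:R / 2%:R) ^+ j / 2%:R ^+ j :> R.
    by rewrite -expr_div_n; congr (_ ^+ j); field.
  rewrite -UX.
  move: ((3%:R / 2%:R) ^+ j) ((104%:R * 96%:R) : R) => Y n9.
  transitivity (432%:R * Y * U ^+ 2 * (n9 + 14%:R * C) * h ^+ 2 * (H / d j)); first by ring.
  by rewrite Hd; ring.
rewrite -mulr_suml; set K := X * _ * _ * _.
have K0 : 0 <= K.
  have C1 : 0 <= 104%:R * 96%:R + 14%:R * C by rewrite addr_ge0 ?mulr_ge0 ?ler0n.
  apply: mulr_ge0; last by rewrite exprn_ge0 // ltW.
  exact: mulr_ge0 (mulr_ge0 (ltW X0) (ler0n _ _)) C1.
apply: le_trans (ler_wpM2r K0 (geometric_le4 R M)) _.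
by rewrite /K le_eqVlt; apply/orP; left; apply/eqP; ring.
Qed.

(** The sum over [n] is at most [4 * b ^ (3/2) / H], and the remaining series of
    [b ^ (-3/2)] is at most 3. *)
Lemma main_term_bounds (R : realType) (N : nat) (H : R) : 0 < H ->
  0 <= \sum_(1 <= b < N) (((moebius b)%:~R ^+ 2 / b%:R ^+ 3) *
       \big[+%R/0]_(1 <= n <oo) (sinc (n%:R * H / b%:R `^ (3%:R / 2%:R))) ^+ 2) <= 12%:R / H.
Proof.
move=> H0; pose F (b : nat) : R := (moebius b)%:~R ^+ 2 / b%:R ^+ 3 *
  \big[+%R/0]_(1 <= n <oo) sinc (n%:R * H / b%:R `^ (3%:R / 2%:R)) ^+ 2.
rewrite -[X in _ <= X <= _]/(\sum_(1 <= b < N) F b).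
have Fb b : (0 < b)%N -> 0 <= F b <= 4%:R / H * (pow32 b%:R)^-1.
  move=> b0; have p0 : 0 < pow32 b%:R :> R by apply: pow32_gt0; rewrite ltr0n.
  have t0 : 0 < H / pow32 b%:R by rewrite divr_gt0.
  have := sinc_sum_le t0; rewrite /F.
  under eq_fun do under eq_bigr => n _ do rewrite mulrA -pow32_powR ?ler0n //.
  set S := \big[+%R/0]_(1 <= n <oo) _ => /andP[S0 S1].
  have m2 : 0 <= ((moebius b)%:~R : R) ^+ 2 <= 1.
    rewrite sqr_ge0 /= /moebius; case: ifP => _; last by rewrite expr0n.
    by rewrite rmorphXn /= rmorphN1 -exprM mulnC exprM sqrrN expr1n expr1n.
  have b3 : 0 < b%:R ^+ 3 :> R by rewrite exprn_gt0 // ltr0n.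
  case/andP: m2 => m0 m1; rewrite mulr_ge0 ?divr_ge0 ?(ltW b3) //=.
  apply: (@le_trans _ _ ((1 / b%:R ^+ 3) * (4%:R / (H / pow32 b%:R)))).
    by apply: ler_pM => //; rewrite ?divr_ge0 ?(ltW b3) // ler_wpM2r // invr_ge0 ltW.
  rewrite -(sqr_pow32 (ler0n R b)) le_eqVlt; apply/orP; left; apply/eqP.
  by field; rewrite !gt_eqF.
apply/andP; split.
  by rewrite big_nat; apply: sumr_ge0 => b /andP[b0 _]; case/andP: (Fb b b0).
apply: (@le_trans _ _ (4%:R / H * \sum_(1 <= b < N) (pow32 b%:R)^-1)).
  rewrite mulr_sumr big_nat [leRHS]big_nat; apply: ler_sum => b /andP[b0 _].
  by case/andP: (Fb b b0).
rewrite (_ : 12%:R / H = 4%:R / H * 3%:R); last by ring.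
by rewrite ler_wpM2l ?pow32_sum_le // divr_ge0 // ltW.
Qed.

Lemma log_le_power (R : realType) (X e : R) : 1 <= X -> 0 < e ->
  1 + ln (Num.truncn (9%:R * X)).+1%:R <= (11%:R + e^-1) * X `^ e.
Proof.
move=> X1 e0; have X0 : 0 < X by lra.
have Xe1 : 1 <= X `^ e by rewrite -(powRr0 X) ler_powR // ltW.
have M10 : (Num.truncn (9%:R * X)).+1%:R <= 10%:R * X.
  have : (Num.truncn (9%:R * X))%:R <= 9%:R * X by rewrite truncn_le; lra.
  by rewrite -natr1; lra.
have l1 : ln (Num.truncn (9%:R * X)).+1%:R <= ln (10%:R * X).
  by rewrite ler_ln ?posrE ?ltr0n // mulr_gt0.
have l2 : ln (10%:R * X) = ln 10%:R + ln X by rewrite lnM ?posrE.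
have l3 : ln 10%:R <= 9%:R :> R.
  have -> : 10%:R = 1 + 9%:R :> R by ring.
  by apply: le_ln1Dx; lra.
have l4 : ln X <= e^-1 * X `^ e.
  rewrite mulrC ler_pdivlMr // mulrC -ln_powR.
  have -> : X `^ e = 1 + (X `^ e - 1) by ring.
  apply: le_trans (le_ln1Dx _) _; lra.
lra.
Qed.

(** * Conclusion *)

Theorem proposition1 (R : realType) (eps : R) (heps0 : 0 < eps)
    (heps1 : eps < 1 / 10%:R) :
  exists C1 C2 : R, [/\ 0 < C1, 0 < C2 &
    forall X H : R, 1 <= X ->
      X `^ (3%:R * eps) <= H -> H <= X `^ (1 / 2%:R - eps) ->
      exists theta E : R,
        [/\ `|theta| <= C1 * X `^ (- (eps / 2%:R)),
            `|E| <= C2 * (H `^ (4%:R / 3%:R)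
                          + H `^ (5%:R / 3%:R + eps) / X `^ (1 / 16%:R)
                          + H `^ (2%:R + eps) / X `^ (1 / 8%:R)) &
            1 / X * (\int[lebesgue_measure]_(x in `[X, 2%:R * X])
              (let y := 2%:R * Num.sqrt x * H + H ^+ 2 in
               `|(squarefull_count (x + y))%:R - (squarefull_count x)%:R
                 - zeta (3%:R / 2%:R) / zeta 3%:R * H| ^+ 2))
            = (1 + theta) *
                (2%:R * H ^+ 2 *
                 \sum_(1 <= b < (Num.truncn (X `^ (1 / 4%:R))).+1)
                   (((moebius b)%:~R ^+ 2 / b%:R ^+ 3) *
                    \big[+%R/0]_(1 <= n <oo)
                      (sinc (n%:R * H / b%:R `^ (3%:R / 2%:R))) ^+ 2))
              + E]].
Proof.
pose C : R := 11%:R + (2%:R * eps)^-1.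
have C0 : 0 < C by rewrite ltr_wpDr ?invr_ge0 ?mulr_ge0 // ltW.
have [K K0 KE] : exists2 K : R, 0 <= K & 32%:R + 1728%:R * ((104%:R * 96%:R) + 14%:R * C) = K.
  exists (32%:R + 1728%:R * ((104%:R * 96%:R) + 14%:R * C)); last exact: erefl.
  by rewrite addr_ge0 ?ler0n ?mulr_ge0 ?ler0n ?addr_ge0 ?mulr_ge0 ?ler0n ?(ltW C0).
exists 1, (K + 24%:R); split; [exact: ltr01 | by rewrite ltr_wpDl ?ltr0n |].
move=> X H X1 XH HX; pose h := H `^ (1 / 3%:R).
have X0 : 0 < X by lra.
have H1 : 1 <= H by apply: le_trans XH; rewrite -[leLHS](powRr0 X) ler_powR // mulr_ge0 // ltW.
have H0 : 0 < H by lra.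
have hpow (n : nat) : h ^+ n = H `^ (n%:R / 3%:R).
  by rewrite -powR_mulrn ?powR_ge0 // /h -powRrM; congr (_ `^ _); ring.
have h3 : h ^+ 3 = H by rewrite hpow divff ?powRr1 // ltW.
have h1 : 1 <= h by rewrite /h -[leLHS](powRr0 H) ler_powR // divr_ge0.
have h0 : 0 < h by lra.
have HU : h ^+ 3 <= Num.sqrt X.
  rewrite h3 -powR12_sqrt; last by lra.
  by apply: le_trans HX _; rewrite ler_powR //; lra.
have LC : 1 + ln (Num.truncn (9%:R * X)).+1%:R <= C * h ^+ 2.
  have e20 : 0 < 2%:R * eps by rewrite mulr_gt0.
  apply: le_trans (log_le_power X1 e20) _.
  rewrite ler_wpM2l ?(ltW C0) // hpow.
  have -> : 2%:R * eps = (3%:R * eps) * (2%:R / 3%:R) by field.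
  by rewrite powRrM; apply: ge0_ler_powR => //; rewrite ?nnegrE ?powR_ge0 ?(ltW H0).
have V := variance_le X1 h1 HU (ltW C0) LC; rewrite h3 KE in V.
set V0 := 1 / X * _ in V *.
have V0_ge0 : 0 <= V0.
  by rewrite mulr_ge0 ?divr_ge0 ?(ltW X0) //; apply: Rintegral_ge0 => x _; apply: sqr_ge0.
have /andP[] := main_term_bounds (Num.truncn (X `^ (1 / 4%:R))).+1 H0.
set S := \sum_(1 <= b < _) _ => S0 S1.
exists 0, (V0 - 2%:R * H ^+ 2 * S); split; last by ring.
  by rewrite normr0 mul1r powR_ge0.
have c0 : 0 <= 2%:R * H ^+ 2 by rewrite mulr_ge0 // sqr_ge0.
have m0 : 0 <= 2%:R * H ^+ 2 * S by rewrite mulr_ge0.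
have Hh : H <= h ^+ 4 by rewrite -h3 ler_weXn2l.
have m1 : 2%:R * H ^+ 2 * S <= 24%:R * h ^+ 4.
  apply: (@le_trans _ _ (2%:R * H ^+ 2 * (12%:R / H))); first by rewrite ler_wpM2l.
  rewrite (_ : 2%:R * H ^+ 2 * (12%:R / H) = 24%:R * H) ?ler_wpM2l //.
  by field; rewrite gt_eqF.
have h4 : 0 <= h ^+ 4 by rewrite exprn_ge0 // ltW.
apply: (@le_trans _ _ ((K + 24%:R) * h ^+ 4)).
  rewrite mulrDl ler_norml; apply/andP; split; last by lra.
  have : 0 <= K * h ^+ 4 by rewrite mulr_ge0.
  lra.
rewrite ler_wpM2l ?addr_ge0 // -(hpow 4%N) -addrA lerDl addr_ge0 // divr_ge0 ?powR_ge0 //.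
Qed.
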